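(* Suppose that $(\bar A,\bar B)$ is controllable, $(\bar A,\bar C_{\mathcal S})$ is observable, and $T_{\mathsf p}\ge n$. Assume further that the partial offline input $\mathbf u^{[T_{\mathsf p},N-1]}$ is persistently exciting of order $n+T_{\mathsf p}+T_{\mathsf f}$. Then the Secure DeePC algorithm (defined in the context) achieves MPC-equivalent performance and constraint satisfaction after a finite transient time almost surely, if the algorithm is feasible at the switching time $\tau_{\rm sw}$ and recursively feasible thereafter.
   Context: **Plant and offline data.** The plant is $x(k+1)=\bar Ax(k)+\bar Bu(k)$, $y(k)=\bar Cx(k)$, with $x(k)\in\mathbb R^n$, $u(k)\in\mathbb R^m$, $y(k)\in\mathbb R^p$. Output indices $\{1,\dots,p\}$ are partitioned into $\mathcal S$ (protected) and $\mathcal U$ (unprotected); subscripts $\mathcal S,\mathcal U$ denote the corresponding subvectors or row-submatrices. The offline data are $(\mathbf u,\widetilde{\mathbf y})$ over $[0,N-1]$ with $\widetilde{\mathbf y}=\mathbf y+\mathbf a$, where $(\mathbf u,\mathbf y)$ is a plant trajectory and $\mathbf a$ is an attack sequence, arbitrary except that $\mathbf a_i\equiv0$ for $i\in\mathcal S$ (so $\widetilde{\mathbf y}_{\mathcal S}=\mathbf y_{\mathcal S}$). Online measurements are attack-free; at $k=0$ the past online data $u^{[-T_{\mathsf p},-1]},y^{[-T_{\mathsf p},-1]}$ are given. **Notation.** $v^{[i,j]}=\mathrm{col}(v(i),\dots,v(j))$. $\mathscr H_q(v^{[i,j]})$ is the block Hankel matrix with $q$ block rows whose columns are $v^{[i,i+q-1]},\dots,v^{[j-q+1,j]}$;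 $v^{[i,j]}$ is persistently exciting (PE) of order $q$ if this matrix has full row rank. $\|x\|_P=\sqrt{x^\top Px}$; $\dagger$ is the Moore–Penrose pseudoinverse. For a data sequence $v$, the first $T_{\mathsf p}$ and last $T_{\mathsf f}$ block rows of $\mathscr H_{T_{\mathsf p}+T_{\mathsf f}}(v)$ are its ''past'' and ''future'' Hankel matrices. **Constraints and costs.** $\mathcal C_u\subseteq\mathbb R^m$, $\mathcal C_y\subseteq\mathbb R^p$ are the input and output constraint sets; superscript $T_{\mathsf f}$ denotes $T_{\mathsf f}$-fold Cartesian product. With references $r^u,r^y$ and positive definite $Q,R$, $J(u^{\mathsf f},y^{\mathsf f})=\sum_{t=k}^{k+T_{\mathsf f}-1}(\|y^{\mathsf f}(t)-r^y(t)\|_Q^2+\|u^{\mathsf f}(t)-r^u(t)\|_R^2)$. $J_{\mathcal S}(u^{\mathsf f},y^{\mathsf f}_{\mathcal S})$ is defined likewise, considering only the outputs in $\mathcal S$. $\mathcal W\subset\mathbb R^m$ has $0\in\operatorname{int}\mathcal W$; $\bar{\mathcal C}_u=\mathcal C_u\ominus\mathcal W$ (Pontryagin difference) and $\bar{\mathcal C}_y=\{\psi_{\mathcal S}:\psi\in\mathcal C_y\}$. The dither $w(k)\in\mathcal W$ is an i.i.d. random signal with an absolutely continuous distribution supported on $\mathcal W$. **Secure DeePC algorithm.** Let $\tau_{\rm pe}$ be the first time $k\ge0$ at which the online input $u^{[-T_{\mathsf p},k-1]}$ is PE of order $2T_{\mathsf p}$ ($+\infty$ if there is none), and let the switching time be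 $\tau_{\rm sw}=\tau_{\rm pe}+1$. *Phase I* ($0\le k<\tau_{\rm sw}$): let $\mathbf U^{\mathsf p},\mathbf U^{\mathsf f}$ and $\widetilde{\mathbf Y}_{\mathcal S}^{\mathsf p},\widetilde{\mathbf Y}_{\mathcal S}^{\mathsf f}$ be the past/future Hankel matrices of $\mathbf u$ and $\widetilde{\mathbf y}_{\mathcal S}$. Solve: minimize $J_{\mathcal S}(u^{\mathsf f},y_{\mathcal S}^{\mathsf f})$ over $(g,u^{\mathsf f},y_{\mathcal S}^{\mathsf f})$ subject to $\mathbf U^{\mathsf p}g=u^{[k-T_{\mathsf p},k-1]}$, $\widetilde{\mathbf Y}^{\mathsf p}_{\mathcal S}g=y_{\mathcal S}^{[k-T_{\mathsf p},k-1]}$, $\mathbf U^{\mathsf f}g=u^{\mathsf f}$, $\widetilde{\mathbf Y}^{\mathsf f}_{\mathcal S}g=y_{\mathcal S}^{\mathsf f}$, $u^{\mathsf f}\in\bar{\mathcal C}_u^{T_{\mathsf f}}$, $y_{\mathcal S}^{\mathsf f}\in\bar{\mathcal C}_y^{T_{\mathsf f}}$. Apply $u(k)=u^{\mathsf f}(k)+w(k)$. *Reconstruction* (at $k=\tau_{\rm sw}$): with $\zeta(t)=\mathrm{col}(u^{[t-T_{\mathsf p},t-1]},y_{\mathcal S}^{[t-T_{\mathsf p},t-1]})$, $Z(k)=[\zeta(0)\cdots\zeta(k-1)]$, $Y_{\mathcal U}(k)=[y_{\mathcal U}(0)\cdots y_{\mathcal U}(k-1)]$, set $F=Y_{\mathcal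 U}(\tau_{\rm sw})Z(\tau_{\rm sw})^\dagger$ and $\widehat{\mathbf y}_{\mathcal U}(t)=F\,\mathrm{col}(\mathbf u^{[t-T_{\mathsf p},t-1]},\mathbf y_{\mathcal S}^{[t-T_{\mathsf p},t-1]})$ for $t\in[T_{\mathsf p},N-1]$. Let $\widehat{\mathbf U}^{\mathsf p},\widehat{\mathbf U}^{\mathsf f},\widehat{\mathbf Y}^{\mathsf p},\widehat{\mathbf Y}^{\mathsf f}$ be the past/future Hankel matrices of $\mathbf u^{[T_{\mathsf p},N-1]}$ and of the output sequence on $[T_{\mathsf p},N-1]$ with $\mathcal S$-components $\widetilde{\mathbf y}_{\mathcal S}$ and $\mathcal U$-components $\widehat{\mathbf y}_{\mathcal U}$. (The attack is also identified as $\widehat{\mathbf a}_{\mathcal U}=\widetilde{\mathbf y}_{\mathcal U}-\widehat{\mathbf y}_{\mathcal U}$ on this interval.) *Phase II* ($k\ge\tau_{\rm sw}$): solve: minimize $J(u^{\mathsf f},y^{\mathsf f})$ over $(g,u^{\mathsf f},y^{\mathsf f})$ subject to $\widehat{\mathbf U}^{\mathsf p}g=u^{[k-T_{\mathsf p},k-1]}$, $\widehat{\mathbf Y}^{\mathsf p}g=y^{[k-T_{\mathsf p},k-1]}$, $\widehat{\mathbf U}^{\mathsf f}g=u^{\mathsf f}$, $\widehat{\mathbf Y}^{\mathsf f}g=y^{\mathsf f}$, $u^{\mathsf f}\in\mathcal C_u^{T_{\mathsf f}}$, $y^{\mathsf f}\in\mathcal C_y^{T_{\mathsf f}}$. Apply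 $u(k)=u^{\mathsf f}(k)$. **Terminology.** ''MPC-equivalent'' means that the optimal control sequence and corresponding system output obtained by the algorithm coincide with those of the model predictive control (MPC) problem with prediction horizon $T_{\mathsf f}$, i.e. the problem of minimizing the same cost $J$ under the same constraints $u^{\mathsf f}\in\mathcal C_u^{T_{\mathsf f}}$, $y^{\mathsf f}\in\mathcal C_y^{T_{\mathsf f}}$, with predictions generated by the true plant model from the current state. ''Constraint satisfaction'' refers to the constraint sets $\mathcal C_u$ and $\mathcal C_y$. *)

(* Defs.v *)
From HB Require Import structures.
From mathcomp Require Import all_boot all_order all_algebra.
From mathcomp Require Import all_classical all_reals all_analysis.

Set Implicit Arguments.
Unset Strict Implicit.
Unset Printing Implicit Defensive.

Import Order.TTheory GRing.Theory Num.Theory.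
Import numFieldNormedType.Exports.
Local Open Scope classical_set_scope.
Local Open Scope ring_scope.

Section LinearAlgebra.
Context {R : realType}.

(* For S : {set 'I_p}, [subvec S M] keeps the rows of M with index in S, in
   increasing order; on column vectors this is the subvector indexed by S. *)
Definition subvec (p q : nat) (S : {set 'I_p}) (M : 'M[R]_(p, q)) :
    'M[R]_(#|S|, q) :=
  rowsub (fun i : 'I_#|S| => enum_val i) M.

(* The vector with S-part [a] and (~: S)-part [b]: the transpose of the
   row-selection matrix [subvec S 1%:M] puts the entries of [a] back at the
   positions listed in S and fills the others with 0. *)
Definition merge (p : nat) (S : {set 'I_p})
    (a : 'cV[R]_#|S|) (b : 'cV[R]_#|~: S|) : 'cV[R]_p :=
  (subvec S 1%:M)^T *m a + (subvec (~: S) 1%:M)^T *m b.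

Definition posdef (q : nat) (M : 'M[R]_q) : Prop :=
  M^T = M /\ forall x : 'cV[R]_q, x != 0 -> 0 < (x^T *m M *m x) 0 0.

Definition wnorm (q : nat) (M : 'M[R]_q) (x : 'cV[R]_q) : R :=
  Num.sqrt ((x^T *m M *m x) 0 0).

Definition penrose (a b : nat) (Z : 'M[R]_(a, b)) (X : 'M[R]_(b, a)) : Prop :=
  [/\ Z *m X *m Z = Z, X *m Z *m X = X,
      (Z *m X)^T = Z *m X & (X *m Z)^T = X *m Z].

(* Moore-Penrose pseudoinverse; [pinvmx] of mxalgebra is only a one-sided
   generalized inverse and need not satisfy the symmetry conditions. *)
Definition pinv (a b : nat) (Z : 'M[R]_(a, b)) : 'M[R]_(b, a) :=
  xget 0 [set X | penrose Z X].

Lemma gram_unit (a b : nat) (M : 'M[R]_(a, b)) :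
  row_free M -> M *m M^T \in unitmx.
Proof.
have sq0 (v : 'rV[R]_b) : v *m v^T = 0 -> v = 0.
  move=> /matrixP /(_ 0 0); rewrite !mxE => /eqP.
  rewrite psumr_eq0 => [/allP z|j _]; last by rewrite mxE -expr2 sqr_ge0.
  apply/rowP => j; rewrite [RHS]mxE; apply/eqP.
  by have := z j (mem_index_enum _); rewrite implyTb mxE -expr2 sqrf_eq0.
move=> fM; rewrite -row_free_unit; apply/inj_row_free => v vM.
apply: (row_free_inj fM); rewrite mul0mx; apply: sq0.
by rewrite trmx_mul mulmxA -(mulmxA v) vM mul0mx.
Qed.

Lemma penrose_unique (a b : nat) (Z : 'M[R]_(a, b)) (X Y : 'M[R]_(b, a)) :
  penrose Z X -> penrose Z Y -> X = Y.
Proof.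
move=> [x1 x2 x3 x4] [y1 y2 y3 y4].
have e1 : Z *m X = Z *m Y.
  have h : Z *m Y *m (Z *m X) = Z *m X by rewrite mulmxA y1.
  by rewrite -x3 -h trmx_mul x3 y3 mulmxA x1.
have e2 : X *m Z = Y *m Z.
  have h : X *m Z *m (Y *m Z) = X *m Z by rewrite -mulmxA (mulmxA Z) y1.
  by rewrite -x4 -h trmx_mul x4 y4 -mulmxA (mulmxA Z) x1.
by rewrite -x2 e2 -mulmxA e1 mulmxA y2.
Qed.

Lemma pinvP (a b : nat) (Z : 'M[R]_(a, b)) : penrose Z (pinv Z).
Proof.
suff [X PX] : exists X, penrose Z X by exact: (xgetPex 0 (ex_intro _ X PX)).
have uT : row_base Z *m (row_base Z)^T \in unitmx.
  by apply: gram_unit; exact: row_base_free.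
have uL : (col_base Z)^T *m col_base Z \in unitmx.
  rewrite -{2}(trmxK (col_base Z)); apply: gram_unit.
  by rewrite /row_free mxrank_tr; have := col_base_full Z; rewrite /row_full.
move: (col_base Z) (row_base Z) (mulmx_base Z) uT uL.
move: (\rank Z) => r L T /esym ZE uT uL.
pose G := invmx (T *m T^T); pose H := invmx (L^T *m L).
have GT : T *m T^T *m G = 1%:M by rewrite mulmxV.
have HL : H *m (L^T *m L) = 1%:M by rewrite mulVmx.
have sG : G^T = G by rewrite /G trmx_inv trmx_mul trmxK.
have sH : H^T = H by rewrite /H trmx_inv trmx_mul trmxK.
have ZX : Z *m (T^T *m G *m H *m L^T) = L *m H *m L^T.
  by rewrite ZE -!mulmxA (mulmxA T) (mulmxA (T *m _)) GT mul1mx.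
have XZ : T^T *m G *m H *m L^T *m Z = T^T *m G *m T.
  by rewrite ZE -!mulmxA (mulmxA L^T) (mulmxA H) HL mul1mx.
exists (T^T *m G *m H *m L^T); split.
- by rewrite ZX ZE -!mulmxA (mulmxA L^T) (mulmxA H) HL mul1mx.
- by rewrite XZ -!mulmxA (mulmxA T) (mulmxA (T *m _)) GT mul1mx.
- by rewrite ZX !trmx_mul trmxK sH mulmxA.
- by rewrite XZ !trmx_mul trmxK sG mulmxA.
Qed.

End LinearAlgebra.

Section Signals.
Context {R : realType}.

(* A signal is a function of integer time; only its values on the time
   interval under consideration matter. [stack v i q] is
   col(v(i), ..., v(i+q-1)). *)
Definition stack (d : nat) (v : int -> 'cV[R]_d) (i : int) (q : nat) :
    'cV[R]_(\sum_(s < q) d) :=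
  \mxcol_(s < q) v (i + s%:Z).

Definition hankel_cols (d : nat) (v : int -> 'cV[R]_d) (i : int) (q c : nat) :
    'M[R]_(\sum_(s < q) d, c) :=
  \matrix_(r < \sum_(s < q) d, l < c) stack v (i + l%:Z) q r 0.

(* Block Hankel matrix with q block rows of the length-L signal
   v(i), ..., v(i+L-1): it has L - q + 1 columns, and none when L < q. *)
Definition hankel (d : nat) (v : int -> 'cV[R]_d) (i : int) (L q : nat) :=
  hankel_cols v i q (L.+1 - q).

Definition pe (d : nat) (v : int -> 'cV[R]_d) (i : int) (L q : nat) : bool :=
  row_free (hankel v i L q).

(* First a and last b block rows of [hankel v i L (a + b)]. *)
Definition past_hankel (d : nat) (v : int -> 'cV[R]_d) (i : int) (L a b : nat) :=
  hankel_cols v i a (L.+1 - (a + b)).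

Definition future_hankel (d : nat) (v : int -> 'cV[R]_d) (i : int) (L a b : nat) :=
  hankel_cols v (i + a%:Z) b (L.+1 - (a + b)).

End Signals.

Section LinearSystems.
Context {R : realType}.

Fixpoint state (n m : nat) (A : 'M[R]_n) (B : 'M[R]_(n, m))
    (x0 : 'cV[R]_n) (u : nat -> 'cV[R]_m) (t : nat) : 'cV[R]_n :=
  if t is s.+1 then A *m state A B x0 u s + B *m u s else x0.

Definition controllable (n m : nat) (A : 'M[R]_n) (B : 'M[R]_(n, m)) : Prop :=
  forall x0 x1 : 'cV[R]_n, exists (T : nat) (u : nat -> 'cV[R]_m),
    state A B x0 u T = x1.

Definition observable (n q : nat) (A : 'M[R]_n) (C : 'M[R]_(q, n)) : Prop :=
  forall x0 x1 : 'cV[R]_n,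
    (forall t : nat, C *m iter t (mulmx A) x0 = C *m iter t (mulmx A) x1) ->
    x0 = x1.

End LinearSystems.

Section Optimization.
Context {R : realType}.

Definition minimizer (T : Type) (feas : set T) (J : T -> R) (z : T) : Prop :=
  feas z /\ forall z', feas z' -> J z <= J z'.

Definition pontryagin_diff (d : nat) (X W : set 'cV[R]_d) : set 'cV[R]_d :=
  [set a | forall b, W b -> X (a + b)].

Definition cost (m q T : nat) (Q : 'M[R]_q) (Ru : 'M[R]_m)
    (ru : int -> 'cV[R]_m) (ry : int -> 'cV[R]_q) (k : int)
    (uf : 'I_T -> 'cV[R]_m) (yf : 'I_T -> 'cV[R]_q) : R :=
  \sum_(j < T) (wnorm Q (yf j - ry (k + j%:Z)) ^+ 2
              + wnorm Ru (uf j - ru (k + j%:Z)) ^+ 2).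

(* Decision variables (g, u^f, y^f); [plan_u z j] is u^f(k + j). *)
Record plan (c T m q : nat) := Plan {
  plan_g : 'cV[R]_c;
  plan_u : 'I_T -> 'cV[R]_m;
  plan_y : 'I_T -> 'cV[R]_q
}.

(* Feasible set at time k, with the predictor built from the data
   (vd, zd) on [i, i + L - 1] and the online signals (u, y). *)
Definition deepc_feasible (m q a b : nat)
    (vd : int -> 'cV[R]_m) (zd : int -> 'cV[R]_q) (i : int) (L : nat)
    (u : int -> 'cV[R]_m) (y : int -> 'cV[R]_q)
    (X : set 'cV[R]_m) (Y : set 'cV[R]_q) (k : int) :
    set (plan (L.+1 - (a + b)) b m q) :=
  [set z | [/\ past_hankel vd i L a b *m plan_g z = stack u (k - a%:Z) a,
               past_hankel zd i L a b *m plan_g z = stack y (k - a%:Z) a,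
               future_hankel vd i L a b *m plan_g z = \mxcol_(j < b) plan_u z j,
               future_hankel zd i L a b *m plan_g z = \mxcol_(j < b) plan_y z j
             & forall j, X (plan_u z j) /\ Y (plan_y z j)]].

End Optimization.

(* [prot] is the set S of protected outputs, its complement being U; the offline
   data (ud, yd) over [0, Nd - 1] contain the attacked output. *)
Record deepc (R : realType) (m p : nat) := Deepc {
  prot : {set 'I_p};
  Tp : nat;
  Tf : nat;
  Tf_gt0 : (0 < Tf)%N;
  Nd : nat;
  ud : int -> 'cV[R]_m;
  yd : int -> 'cV[R]_p;
  Cu : set 'cV[R]_m;
  Cy : set 'cV[R]_p;
  Wd : set 'cV[R]_m;
  Qw : 'M[R]_p;
  Rw : 'M[R]_m;
  ru : int -> 'cV[R]_m;
  ry : int -> 'cV[R]_p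
}.

(* (ud, yo) restricted to [0, N-1] is a plant trajectory with state xd, and the
   recorded output is yo plus an attack that vanishes on the protected outputs. *)
Definition offline_data (R : realType) (n m p : nat)
    (A : 'M[R]_n) (B : 'M[R]_(n, m)) (C : 'M[R]_(p, n)) (D : deepc R m p)
    (xd : int -> 'cV[R]_n) (yo atk : int -> 'cV[R]_p) : Prop :=
  [/\ forall t : int, 0 <= t -> t + 1 < (Nd D)%:Z ->
        xd (t + 1) = A *m xd t + B *m ud D t,
      forall t : int, 0 <= t < (Nd D)%:Z -> yo t = C *m xd t,
      forall t : int, 0 <= t < (Nd D)%:Z -> yd D t = yo t + atk t
    & forall t : int, 0 <= t < (Nd D)%:Z ->
        forall i, i \in prot D -> atk t i 0 = 0].

Section Algorithm.
Context {R : realType} {m p : nat}.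
Context (D : deepc R m p).
Implicit Types (u : int -> 'cV[R]_m) (y : int -> 'cV[R]_p) (k s : nat).

Local Notation S := (prot D).
Local Notation U := (~: prot D).

Definition first (q : nat) (f : 'I_(Tf D) -> 'cV[R]_q) : 'cV[R]_q :=
  f (Ordinal (Tf_gt0 D)).

Definition J k (uf : 'I_(Tf D) -> 'cV[R]_m) (yf : 'I_(Tf D) -> 'cV[R]_p) : R :=
  cost (Qw D) (Rw D) (ru D) (ry D) k%:Z uf yf.

(* The weight on the protected outputs is the principal submatrix of Q. *)
Definition JS k (uf : 'I_(Tf D) -> 'cV[R]_m) (yf : 'I_(Tf D) -> 'cV[R]_#|S|) : R :=
  cost (mxsub (fun i : 'I_#|S| => enum_val i) (fun i : 'I_#|S| => enum_val i) (Qw D))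
    (Rw D) (ru D) (fun t => subvec S (ry D t)) k%:Z uf yf.

(* u^{[-Tp, k-1]}, of length Tp + k, is persistently exciting of order 2 Tp. *)
Definition online_pe u k : bool :=
  pe u (- (Tp D)%:Z) (Tp D + k) (2 * Tp D).

(* [None] stands for +oo. *)
Definition tau_pe u : option nat :=
  if pselect (exists k, online_pe u k) is left h then Some (ex_minn h) else None.

Definition tau_sw u : option nat := omap succn (tau_pe u).

Definition before_sw u k : bool :=
  if tau_sw u is Some s then (k < s)%N else true.

Definition plan1 : Type := plan (R := R) ((Nd D).+1 - (Tp D + Tf D)) (Tf D) m #|S|.

Definition phase1_feasible u y k : set plan1 :=
  deepc_feasible (ud D) (fun t => subvec S (yd D t)) 0 (L := Nd D)
    u (fun t => subvec S (y t))
    (pontryagin_diff (Cu D) (Wd D)) (subvec S @` Cy D) k%:Z.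

Definition phase1_optimal u y k : plan1 -> Prop :=
  minimizer (phase1_feasible u y k) (fun z => JS k (plan_u z) (plan_y z)).

Definition zeta u y (t : int) :=
  col_mx (stack u (t - (Tp D)%:Z) (Tp D))
         (stack (fun t' => subvec S (y t')) (t - (Tp D)%:Z) (Tp D)).

Definition Zmat u y k := \matrix_(r < _, l < k) zeta u y l%:Z r 0.

Definition YUmat y k : 'M[R]_(#|U|, k) :=
  \matrix_(r < _, l < k) subvec U (y l%:Z) r 0.

Definition Fmat u y s := YUmat y s *m pinv (Zmat u y s).

(* Reconstructed offline output; the protected part of [yd] is not attacked. *)
Definition yhat u y s (t : int) : 'cV[R]_p :=
  merge (subvec S (yd D t)) (Fmat u y s *m zeta (ud D) (yd D) t).

Definition plan2 : Type :=
  plan (R := R) ((Nd D - Tp D).+1 - (Tp D + Tf D)) (Tf D) m p.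

(* The online pair (u, y) is used both for the reconstruction, made at the
   switching time s, and for the initial condition at the current time k. *)
Definition phase2_feasible u y s k : set plan2 :=
  deepc_feasible (ud D) (yhat u y s) (Tp D)%:Z (L := Nd D - Tp D)
    u y (Cu D) (Cy D) k%:Z.

Definition phase2_optimal u y s k : plan2 -> Prop :=
  minimizer (phase2_feasible u y s k) (fun z => J k (plan_u z) (plan_y z)).

(* One closed-loop run: state, input, output, dither, and the plans returned by
   the solver in the two phases. [run_plan1 k] matters only before the switching
   time and [run_plan2 k] only from it on. *)
Record run (n : nat) := Run {
  run_x : int -> 'cV[R]_n;
  run_u : int -> 'cV[R]_m;
  run_y : int -> 'cV[R]_p;
  run_w : nat -> 'cV[R]_m;
  run_plan1 : nat -> plan1;
  run_plan2 : nat -> plan2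
}.

(* Where the optimization problem of the current phase is infeasible nothing is
   required of the plan. *)
Definition secure_deepc (n : nat)
    (A : 'M[R]_n) (B : 'M[R]_(n, m)) (C : 'M[R]_(p, n))
    (up : int -> 'cV[R]_m) (yp : int -> 'cV[R]_p) (e : run n) : Prop :=
  [/\ forall t : int, - (Tp D)%:Z <= t < 0 -> run_u e t = up t /\ run_y e t = yp t,
      forall t : int, - (Tp D)%:Z <= t ->
        run_x e (t + 1) = A *m run_x e t + B *m run_u e t /\
        run_y e t = C *m run_x e t,
      forall k, before_sw (run_u e) k ->
        (phase1_feasible (run_u e) (run_y e) k !=set0 ->
         phase1_optimal (run_u e) (run_y e) k (run_plan1 e k)) /\
        run_u e k%:Z = first (plan_u (run_plan1 e k)) + run_w e k
    & forall s, tau_sw (run_u e) = Some s -> forall k, (s <= k)%N ->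
        (phase2_feasible (run_u e) (run_y e) s k !=set0 ->
         phase2_optimal (run_u e) (run_y e) s k (run_plan2 e k)) /\
        run_u e k%:Z = first (plan_u (run_plan2 e k))].

(* Holds vacuously when tau_sw = +oo, so assuming it does not make the switching
   time finite. *)
Definition recursively_feasible (n : nat) (e : run n) : Prop :=
  forall s, tau_sw (run_u e) = Some s ->
    phase2_feasible (run_u e) (run_y e) s s !=set0 /\
    forall k, (s <= k)%N ->
      phase2_feasible (run_u e) (run_y e) s k !=set0 ->
      phase2_feasible (run_u e) (run_y e) s k.+1 !=set0.

Definition mpc_feasible (n : nat)
    (A : 'M[R]_n) (B : 'M[R]_(n, m)) (C : 'M[R]_(p, n)) (x : 'cV[R]_n) :
    set (('I_(Tf D) -> 'cV[R]_m) * ('I_(Tf D) -> 'cV[R]_p)) :=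
  [set z | (forall j, Cu D (z.1 j) /\ Cy D (z.2 j)) /\
     exists xf : nat -> 'cV[R]_n, xf 0%N = x /\
       forall j : 'I_(Tf D),
         xf j.+1 = A *m xf j + B *m z.1 j /\ z.2 j = C *m xf j].

Definition mpc_optimal (n : nat)
    (A : 'M[R]_n) (B : 'M[R]_(n, m)) (C : 'M[R]_(p, n)) (x : 'cV[R]_n) k :=
  minimizer (mpc_feasible A B C x) (fun z => J k z.1 z.2).

(* Since minimizers need not be unique when the constraint sets are not convex,
   the two problems are required to have the same set of optimal (u^f, y^f);
   moreover the pair found by the run is one of them, and its first elements are
   the applied input and the measured output. *)
Definition mpc_equivalent (n : nat)
    (A : 'M[R]_n) (B : 'M[R]_(n, m)) (C : 'M[R]_(p, n)) (e : run n) s k : Prop :=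
  let z := run_plan2 e k in
  [/\ forall uf yf,
        (exists g, phase2_optimal (run_u e) (run_y e) s k (Plan g uf yf)) <->
        mpc_optimal A B C (run_x e k%:Z) k (uf, yf),
      mpc_optimal A B C (run_x e k%:Z) k (plan_u z, plan_y z),
      run_u e k%:Z = first (plan_u z)
    & run_y e k%:Z = first (plan_y z)].

Definition constraints_hold (n : nat) (e : run n) k : Prop :=
  Cu D (run_u e k%:Z) /\ Cy D (run_y e k%:Z).

End Algorithm.

(* Borel sigma-algebra of R^d, generated by the coordinates. *)
Section VectorMeasurable.
Context {R : realType} {d : nat}.

Definition vcoord (i : 'I_d) (x : 'cV[R]_d) : measurableTypeR R := x i 0.

Let vec_set0 : g_sigma_preimage vcoord set0.
Proof. exact: sigma_algebra0. Qed.

Let vec_setC A : g_sigma_preimage vcoord A -> g_sigma_preimage vcoord (~` A).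
Proof. exact: sigma_algebraC. Qed.

Let vec_bigcup (F : (set 'cV[R]_d)^nat) :
  (forall i, g_sigma_preimage vcoord (F i)) ->
  g_sigma_preimage vcoord (\bigcup_i (F i)).
Proof. exact: sigma_algebra_bigcup. Qed.

HB.instance Definition _ := @isMeasurable.Build default_measure_display
  'cV[R]_d (g_sigma_preimage vcoord) vec_set0 vec_setC vec_bigcup.

End VectorMeasurable.

Section Dither.
Local Open Scope ereal_scope.
Context {R : realType}.

Definition box (q : nat) (a b : 'cV[R]_q) : set 'cV[R]_q :=
  [set x | forall i, (a i 0 <= x i 0 <= b i 0)%R].

Definition box_vol (q : nat) (a b : 'cV[R]_q) : R :=
  (\prod_(i < q) Num.max 0 (b i 0 - a i 0))%R.

Definition lebesgue_outer (q : nat) (N : set 'cV[R]_q) : \bar R :=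
  ereal_inf [set v | exists a b : nat -> 'cV[R]_q,
    N `<=` \bigcup_l box (a l) (b l) /\
    v = \sum_(0 <= l <oo) (box_vol (a l) (b l))%:E].

Context {d : measure_display} {Omega : measurableType d}.
Context (P : probability Omega R).

(* i.i.d. random vectors with values in W almost surely, whose common
   distribution is absolutely continuous with respect to Lebesgue measure. *)
Definition iid_dither (m : nat) (W : set 'cV[R]_m)
    (w : nat -> Omega -> 'cV[R]_m) : Prop :=
  [/\ forall k, measurable_fun setT (w k),
      forall (I : seq nat) (A : nat -> set 'cV[R]_m), uniq I ->
        (forall k, measurable (A k)) ->
        P (\bigcap_(k in [set` I]) (w k @^-1` A k)) =
        \prod_(k <- I) P (w k @^-1` A k),
      forall k A, measurable A -> P (w k @^-1` A) = P (w 0%N @^-1` A),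
      forall k A, measurable A -> lebesgue_outer A = 0 -> P (w k @^-1` A) = 0
    & forall k, {ae P, forall omega, W (w k omega)}].

(* v(k) depends on the past dither w(0), ..., w(k-1) only. *)
Definition nonanticipative (m : nat) (w v : nat -> Omega -> 'cV[R]_m) : Prop :=
  forall k A, measurable A ->
    g_sigma_preimage (fun j : 'I_k => w j) (v k @^-1` A).

End Dither.

(* Main.v *)
Require Import Defs.
From HB Require Import structures.
From mathcomp Require Import all_boot all_order all_algebra.
From mathcomp Require Import all_classical all_reals all_analysis.
From mathcomp Require Import zify measurable_realfun ring lra.
Import Order.TTheory GRing.Theory Num.Theory.
Import numFieldNormedType.Exports.
Local Open Scope classical_set_scope.
Local Open Scope ring_scope.

(* Probabilistic half: cut the online input into disjoint windows of length 2Tp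
   and place as many of them as there are rows side by side. The determinant of
   this square matrix is affine in each u(k) = v(k) + w(k) separately, v(k) is a
   function of the earlier dither, and w(k) is independent of that past and gives
   mass 0 to every hyperplane; Fubini and induction on the last time show that
   the determinant is almost surely nonzero, so the input is persistently
   exciting at a finite time.

   Deterministic half: Willems' fundamental lemma, applied to the online data,
   writes every offline window as a combination of online ones; an input-output
   window of length Tp >= n determines the state through the protected outputs,
   so F reproduces the unprotected offline outputs exactly. Applied to the
   repaired offline data, the same lemma identifies the feasible set of Phase II
   with that of the MPC problem started at the true state. *)

(** * Willems' fundamental lemma *)

(** The [a i] are the coefficients of the characteristic polynomial, with [a n = 1] so that [A ^+ n]
    can be isolated; for [n = 0] all matrices are equal. *)
Lemma cayley_hamilton_monic (R : comNzRingType) (n : nat) (A : 'M[R]_n) :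
  exists a : nat -> R, a n = 1 /\ \sum_(i < n.+1) a i *: A ^+ i = 0.
Proof.
case: n A => [|n] A; first by exists (fun=> 1); split=> //; apply/matrixP => -[].
exists (fun i => (char_poly A)`_i); split.
  by have := char_poly_monic A; rewrite monicE lead_coefE size_char_poly => /eqP.
rewrite -[RHS](Cayley_Hamilton A) -[in RHS](coefK (char_poly A)) poly_def.
rewrite size_char_poly linear_sum; apply: eq_bigr => i _.
by rewrite linearZ rmorphXn /= horner_mx_X.
Qed.

Lemma mulmx_powD (R : comNzRingType) (n : nat) (A : 'M[R]_n) (i j : nat) :
  A ^+ (i + j) = A ^+ i *m A ^+ j.
Proof. exact: exprD. Qed.

Lemma iter_mulmx (R : comNzRingType) (n q : nat) (A : 'M[R]_n) (x : 'M[R]_(n, q)) t :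
  iter t (mulmx A) x = A ^+ t *m x.
Proof.
elim: t => [|t IH] /=; first by rewrite expr0 mul1mx.
by rewrite IH mulmxA -[A *m A ^+ t]exprS.
Qed.

(* By Cayley-Hamilton every power of A is a combination of the first n. *)
Lemma mulmx_pow_eq0 (R : comNzRingType) (n q r : nat) (A : 'M[R]_n)
    (X : 'M[R]_(q, n)) (Y : 'M[R]_(n, r)) :
  (forall j, (j < n)%N -> X *m A ^+ j *m Y = 0) ->
  forall j, X *m A ^+ j *m Y = 0.
Proof.
move=> H; have [a [an]] := cayley_hamilton_monic _ _ A.
rewrite big_ord_recr /= an scale1r => /(canRL (addKr _)); rewrite addr0 => CH.
elim/ltn_ind => j IH; have [/H //|nj] := ltnP j n.
rewrite -(subnK nj) addnC mulmx_powD CH mulNmx mulmxN mulNmx.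
rewrite mulmx_suml mulmx_sumr mulmx_suml big1 ?oppr0 // => i _.
rewrite -scalemxAl -scalemxAr -scalemxAl -mulmx_powD IH ?scaler0 //.
by have := ltn_ord i; lia.
Qed.

Lemma observable_eq0 (R : realType) (n q : nat) (A : 'M[R]_n) (C : 'M[R]_(q, n))
    (x : 'cV[R]_n) :
  observable A C -> (forall j, (j < n)%N -> C *m A ^+ j *m x = 0) -> x = 0.
Proof.
move=> obs /mulmx_pow_eq0 H; apply: obs => t.
by rewrite !iter_mulmx mulmx0 mulmx0 mulmxA H.
Qed.

(** Such a [xi] annihilates every state reachable from 0. Since [xi^T] is reachable, the sum of
    squares [xi *m xi^T] vanishes. *)
Lemma controllable_eq0 (R : realType) (n m : nat) (A : 'M[R]_n) (B : 'M[R]_(n, m))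
    (xi : 'rV[R]_n) :
  controllable A B -> (forall j, (j < n)%N -> xi *m A ^+ j *m B = 0) -> xi = 0.
Proof.
move=> ctr /mulmx_pow_eq0 H; have [T [u Tu]] := ctr 0 xi^T.
have reach t j : xi *m A ^+ j *m state A B 0 u t = 0.
  elim: t j => [|t IH] j /=; first by rewrite mulmx0.
  rewrite mulmxDr !mulmxA H mul0mx addr0 -(mulmxA xi) -[A ^+ j *m A]exprSr.
  exact: IH.
have := reach T 0%N; rewrite Tu expr0 mulmx1 => /matrixP /(_ 0 0).
rewrite !mxE => /eqP; rewrite psumr_eq0 => [/allP z|j _]; last first.
  by rewrite mxE -expr2 sqr_ge0.
apply/rowP => j; rewrite [RHS]mxE; apply/eqP.
by have := z j (mem_index_enum _); rewrite implyTb mxE -expr2 sqrf_eq0.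
Qed.

Lemma col_mulmx (R : comNzRingType) (a b c : nat) (M : 'M[R]_(a, b)) (N : 'M[R]_(b, c)) l :
  col l (M *m N) = M *m col l N.
Proof. by rewrite !colE mulmxA. Qed.

Lemma mulmx_sum_col (R : comNzRingType) (r c : nat) (M : 'M[R]_(r, c)) (g : 'cV[R]_c) :
  M *m g = \sum_(l < c) g l 0 *: col l M.
Proof.
apply/colP => i; rewrite !mxE summxE; apply: eq_bigr => l _.
by rewrite !mxE mulrC.
Qed.

(** Blocks indexed by all of [nat], zero from [q] on, can be shifted in time without dependent
    indices. *)
Lemma mxrow_nat (R : comNzRingType) (q d : nat) (w : 'rV[R]_(\sum_(s < q) d)) :
  exists2 b : nat -> 'rV[R]_d, w = \mxrow_(s < q) b s &
    forall s, (q <= s)%N -> b s = 0.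
Proof.
exists (fun s => if insub s is Some s' then submxrow w s' else 0).
  rewrite -[LHS]submxrowK; apply/eq_mxrowP => s.
  by rewrite insubT //= => ls; congr submxrow; apply: val_inj.
by move=> s qs; rewrite insubF // ltnNge qs.
Qed.

Section Willems.
Variables (R : realType) (n m : nat) (A : 'M[R]_n) (B : 'M[R]_(n, m)).
Variables (x : nat -> 'cV[R]_n) (u : nat -> 'cV[R]_m) (q c : nat).
Hypothesis dyn : forall l, (l.+1 < c)%N -> x l.+1 = A *m x l + B *m u l.

(** Discrete variation-of-constants formula. *)
Lemma state_shift i l : (l + i < c)%N ->
  x (l + i)%N = A ^+ i *m x l + \sum_(s < i) A ^+ (i.-1 - s) *m B *m u (l + s)%N.
Proof.
elim: i => [|i IH] lic; first by rewrite addn0 expr0 mul1mx big_ord0 addr0.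
rewrite addnS dyn; last by rewrite -addnS.
rewrite IH; last by apply: leq_trans lic; rewrite addnS.
rewrite mulmxDr mulmxA -[A *m A ^+ i]exprS -addrA; congr (_ + _).
rewrite big_ord_recr /= subnn expr0 mul1mx; congr (_ + _).
rewrite mulmx_sumr; apply: eq_bigr => s _; rewrite !mulmxA.
rewrite -[A *m A ^+ _]exprS; congr (_ ^+ _ *m _ *m _).
by have := ltn_ord s; lia.
Qed.

Hypothesis ctr : controllable A B.
Hypothesis exc : forall b : nat -> 'rV[R]_m,
  (forall l, (l + n < c)%N -> \sum_(s < n + q) b s *m u (l + s)%N = 0) ->
  forall s, (s < n + q)%N -> b s = 0.

(* Combining the annihilating relation at n+1 consecutive times with the
   coefficients of the characteristic polynomial of A eliminates the state. *)
Lemma willems_kernel (xi : 'rV[R]_n) (eta : nat -> 'rV[R]_m) :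
  (forall l, (l < c)%N -> xi *m x l + \sum_(s < q) eta s *m u (l + s)%N = 0) ->
  xi = 0 /\ forall s, (s < q)%N -> eta s = 0.
Proof.
move=> rel; have [a [an CH]] := cayley_hamilton_monic _ _ A.
(* The rows [xi A^(n-1) B, ..., xi B, eta 0, ..., eta (q-1)], then zeros. Once [x (s + i)] is
   expressed through [x s], the relation at time [s + i] has coefficient [dl (n + r - i)] at
   [u (s + r)]. *)
pose dl k := if (k < n)%N then xi *m A ^+ (n.-1 - k) *m B
             else if (k - n < q)%N then eta (k - n)%N else 0.
pose b s := \sum_(i < n.+1) a i *: dl (n + s - i)%N.
have b0 s : (s < n + q)%N -> b s = 0.
  apply: exc => {}s ls.
  have E (i : 'I_n.+1) : xi *m A ^+ i *m x s
      + \sum_(r < n + q) dl (n + r - i)%N *m u (s + r)%N = 0.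
    have lti := ltn_ord i.
    have lsi : (s + i < c)%N by lia.
    rewrite -[RHS](rel _ lsi) state_shift // mulmxDr mulmxA -addrA; congr (_ + _).
    rewrite -(big_mkord xpredT (fun r => dl (n + r - i)%N *m u (s + r)%N)).
    rewrite (@big_cat_nat _ _ _ i) //=; last by lia.
    rewrite big_mkord mulmx_sumr; congr (_ + _).
      apply: eq_bigr => r _; have ltr := ltn_ord r.
      rewrite /dl ifT ?mulmxA; last by lia.
      by congr (_ *m _ ^+ _ *m _ *m _); lia.
    rewrite -{1}[val i]add0n big_addn (@big_cat_nat _ _ _ q) //=; last by lia.
    rewrite [X in _ + X]big1_seq ?addr0 => [|r]; last first.
      rewrite mem_index_iota => /= lr; rewrite /dl ifF; last by lia.
      by rewrite ifF ?mul0mx //; lia.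
    rewrite big_mkord; apply: eq_bigr => r _; have ltr := ltn_ord r.
    rewrite /dl ifF; last by lia.
    rewrite ifT; last by lia.
    by congr (eta _ *m u _); lia.
  transitivity (\sum_(i < n.+1) a i *:
      \sum_(r < n + q) dl (n + r - i)%N *m u (s + r)%N).
    rewrite [RHS](eq_bigr (fun i : 'I_n.+1 => \sum_(r < n + q)
       (a i *: dl (n + r - i)%N) *m u (s + r)%N)); last first.
      by move=> i _; rewrite scaler_sumr; apply: eq_bigr => r _; rewrite scalemxAl.
    by rewrite exchange_big; apply: eq_bigr => r _; rewrite mulmx_suml.
  (* By Cayley-Hamilton the state terms cancel in the combination with weights [a i], which leaves a
     relation among inputs only. *)
  have Q0 : \sum_(i < n.+1) a i *: (xi *m A ^+ i *m x s) = 0.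
    rewrite -[RHS](mul0mx _ (x s)) -(mulmx0 _ xi) -CH mulmx_sumr mulmx_suml.
    by apply: eq_bigr => i _; rewrite -scalemxAr -scalemxAl.
  rewrite -[LHS]add0r -{1}Q0 -big_split /= big1 // => i _.
  by rewrite -scalerDr E scaler0.
(* Descending induction from the end of [dl]: as [a n = 1], [b s] is [dl s] plus a combination of
   later entries. *)
have d0 : forall k s, (n + q - s <= k)%N -> dl s = 0.
  elim=> [|k IH] s hs.
    by rewrite /dl !ifF //; lia.
  have [sl|sl] := ltnP s (n + q); last by apply: IH; lia.
  have := b0 s sl; rewrite /b big_ord_recr /= an scale1r big1 => [|i _].
    by rewrite add0r; congr (dl _ = _); lia.
  by rewrite IH ?scaler0 //; have := ltn_ord i; lia.
(* The first [n] entries of [dl] are the rows [xi A^j B], so controllability gives [xi = 0]; the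
   next [q] are the [eta s]. *)
split=> [|s sq].
  apply: controllable_eq0 ctr _ => j jn.
  have := d0 _ (n.-1 - j)%N (leqnn _); rewrite /dl ifT; last by lia.
  by rewrite subKn //; lia.
have := d0 _ (n + s)%N (leqnn _); rewrite /dl ifF; last by lia.
by rewrite addKn sq.
Qed.

(** By [willems_kernel] the states stacked over the input Hankel matrix have independent rows; a
    right inverse applied to the prescribed data gives [g]. *)
Lemma willems (x0 : 'cV[R]_n) (v : nat -> 'cV[R]_m) :
  exists g : 'cV[R]_c, \sum_(l < c) g l 0 *: x l = x0 /\
    forall s, (s < q)%N -> \sum_(l < c) g l 0 *: u (l + s)%N = v s.
Proof.
pose X := \matrix_(i < n, l < c) x l i 0.
pose H : 'M[R]_(\sum_(s < q) m, c) :=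
  \matrix_(r, l) (\mxcol_(s < q) u (l + s)%N) r 0.
have colX (l : 'I_c) : col l X = x l by apply/colP => i; rewrite !mxE.
have colH (l : 'I_c) : col l H = \mxcol_(s < q) u (l + s)%N.
  by apply/colP => i; rewrite !mxE.
have /row_freeP [Y XY] : row_free (col_mx X H).
  apply/inj_row_free => w; rewrite -(hsubmxK w) mul_row_col.
  set xi := lsubmx w; set e := rsubmx w => w0.
  have [eta eE _] := mxrow_nat _ _ _ e.
  have [xi0 eta0] : xi = 0 /\ forall s, (s < q)%N -> eta s = 0.
    apply: willems_kernel => l lc; pose l' := Ordinal lc.
    transitivity (col l' (xi *m X + e *m H)); last by rewrite w0 col0.
    by rewrite linearD /= !col_mulmx (colX l') colH eE mul_mxrow_mxcol.
  have -> : e = 0.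
    by rewrite eE -[RHS](mxrow0 (q_ := fun=> m)); apply: eq_mxrow => s; exact: eta0.
  by rewrite xi0 row_mx0.
exists (Y *m col_mx x0 (\mxcol_(s < q) v s)).
set g := Y *m _; have : col_mx X H *m g = col_mx x0 (\mxcol_(s < q) v s).
  by rewrite mulmxA XY mul1mx.
rewrite mul_col_mx => /eq_col_mx [Xg Hg]; split.
  by rewrite -Xg mulmx_sum_col; apply: eq_bigr => l _; rewrite colX.
move=> s sq; have := congr1 (fun M => submxcol M (Ordinal sq)) Hg.
rewrite mxcolK /= => <-; rewrite mulmx_sum_col submxcol_sum.
apply: eq_bigr => l _; rewrite colH.
have -> : submxcol (g l 0 *: \mxcol_(s0 < q) u (l + s0)%N) (Ordinal sq) =
    g l 0 *: submxcol (\mxcol_(s0 < q) u (l + s0)%N) (Ordinal sq).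
  by apply/colP => i; rewrite !mxE.
by rewrite mxcolK.
Qed.

End Willems.

(** * Reconstruction and equivalence with MPC *)

Lemma col_hankel_cols (R : realType) (d : nat) (v : int -> 'cV[R]_d) i q c (l : 'I_c) :
  col l (hankel_cols v i q c) = stack v (i + l%:Z) q.
Proof. by apply/colP => r; rewrite !mxE. Qed.

Lemma hankel_cols_mul (R : realType) (d : nat) (v : int -> 'cV[R]_d) i q c (g : 'cV[R]_c) :
  hankel_cols v i q c *m g =
  \mxcol_(s < q) \sum_(l < c) g l 0 *: v (i + l%:Z + s%:Z).
Proof.
rewrite mulmx_sum_col [RHS]mxcol_sum; apply: eq_bigr => l _.
by rewrite col_hankel_cols; apply/colP => r; rewrite !mxE.
Qed.

Lemma peP (R : realType) (d : nat) (v : int -> 'cV[R]_d) i (L q : nat) :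
  pe v i L q <-> forall b : nat -> 'rV[R]_d,
    (forall l, (l < L.+1 - q)%N -> \sum_(s < q) b s *m v (i + l%:Z + s%:Z) = 0) ->
    forall s, (s < q)%N -> b s = 0.
Proof.
have E (b : nat -> 'rV[R]_d) (l : 'I_(L.+1 - q)) :
    col l ((\mxrow_(s < q) b s) *m hankel v i L q) =
    \sum_(s < q) b s *m v (i + l%:Z + s%:Z).
  by rewrite col_mulmx col_hankel_cols mul_mxrow_mxcol.
split=> [fH b b0 s sq|H].
  suff w0 : \mxrow_(s < q) b s = 0.
    by have := congr1 (fun M => submxrow M (Ordinal sq)) w0; rewrite mxrowK submxrow0.
  apply: (row_free_inj fH); rewrite mul0mx; apply/matrixP => i' l.
  have /matrixP/(_ i' 0) := E b l; rewrite b0 ?ltn_ord // mxE => ->.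
  by rewrite !mxE.
apply/inj_row_free => w; have [b -> _] := mxrow_nat _ _ _ w => bH.
rewrite -[RHS](mxrow0 (q_ := fun=> d)); apply: eq_mxrow => s.
by apply: H => // l lL; rewrite -(E b (Ordinal lL)) bH col0.
Qed.

(** A left annihilator of order [q], padded with zero blocks, is one of order [q']. *)
Lemma pe_le (R : realType) (d : nat) (v : int -> 'cV[R]_d) i (L q q' : nat) :
  (q <= q')%N -> pe v i L q' -> pe v i L q.
Proof.
move=> qq' /peP H; apply/peP => b b0 s sq.
pose b' r := if (r < q)%N then b r else 0.
have := H b' _ s (leq_trans sq qq'); rewrite /b' sq; apply=> l lL.
rewrite -[RHS](b0 l); last by lia.
rewrite -(big_mkord xpredT (fun r => b' r *m v (i + l%:Z + r%:Z))).
rewrite (@big_cat_nat _ _ _ q) //= [X in _ + X]big1_seq ?addr0 => [|r]; last first.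
  by rewrite mem_index_iota => /= lr; rewrite /b' ifF ?mul0mx //; lia.
by rewrite big_mkord; apply: eq_bigr => r _; rewrite /b' ltn_ord.
Qed.

(** The column count is a variable tied by an equation, so that both the online and the offline data
    matrices fit without casts. *)
Lemma willems_pe (R : realType) (n m : nat) (A : 'M[R]_n) (B : 'M[R]_(n, m))
    (x : int -> 'cV[R]_n) (u : int -> 'cV[R]_m) (i : int) (L q c : nat)
    (x0 : 'cV[R]_n) (v : nat -> 'cV[R]_m) :
  controllable A B -> pe u i L (n + q) -> c = (L.+1 - q)%N ->
  (forall l, (l.+1 < c)%N -> x (i + l%:Z + 1) = A *m x (i + l%:Z) + B *m u (i + l%:Z)) ->
  exists g : 'cV[R]_c, \sum_(l < c) g l 0 *: x (i + l%:Z) = x0 /\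
    forall s, (s < q)%N -> \sum_(l < c) g l 0 *: u (i + l%:Z + s%:Z) = v s.
Proof.
move=> ctr pu cE dyn.
have dyn' l : (l.+1 < c)%N -> x (i + l.+1%:Z) =
    A *m x (i + l%:Z) + B *m u (i + l%:Z).
  by move=> lc; rewrite -dyn // -addrA -PoszD addn1.
have [|g [gx gu]] := @willems R n m A B (fun l => x (i + l%:Z))
  (fun l => u (i + l%:Z)) q c dyn' ctr _ x0 v.
  move=> b b0; apply: ((peP _ _ _ _ _ _).1 pu) => l lL.
  rewrite -[RHS](b0 l); last by lia.
  by apply: eq_bigr => s _; rewrite -addrA -PoszD.
exists g; split=> // s sq; rewrite -[RHS]gu //.
by apply: eq_bigr => l _; rewrite -addrA -PoszD.
Qed.

(** The difference of the two trajectories evolves freely under [A], and its first [n] outputs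
    vanish. *)
Lemma state_unique (R : realType) (n m q T : nat) (A : 'M[R]_n) (B : 'M[R]_(n, m))
    (C : 'M[R]_(q, n)) (X X' : nat -> 'cV[R]_n) (v : nat -> 'cV[R]_m) :
  observable A C -> (n <= T)%N ->
  (forall s, (s < T)%N -> X s.+1 = A *m X s + B *m v s) ->
  (forall s, (s < T)%N -> X' s.+1 = A *m X' s + B *m v s) ->
  (forall s, (s < T)%N -> C *m X s = C *m X' s) ->
  forall s, (s <= T)%N -> X s = X' s.
Proof.
move=> obs nT dX dX' CX.
have E s : (s <= T)%N -> X s - X' s = A ^+ s *m (X 0%N - X' 0%N).
  elim: s => [|s IH] sT; first by rewrite expr0 mul1mx.
  rewrite dX // dX' // opprD addrACA subrr addr0 -mulmxBr IH 1?ltnW //.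
  by rewrite mulmxA -[A *m A ^+ s]exprS.
have e0 : X 0%N - X' 0%N = 0.
  apply: observable_eq0 obs _ => j jn; have jT := leq_trans jn nT.
  by rewrite -mulmxA -E 1?ltnW // mulmxBr CX // subrr.
by move=> s /E; rewrite e0 mulmx0 => /eqP; rewrite subr_eq0 => /eqP.
Qed.

Lemma subvec_mul (R : realType) (p q r : nat) (S : {set 'I_p}) (M : 'M[R]_(p, q))
    (N : 'M[R]_(q, r)) : subvec S (M *m N) = subvec S M *m N.
Proof. by rewrite /subvec mul_rowsub_mx. Qed.

(** The transpose of [subvec T 1%:M] times [subvec T v] is the coordinate projection of [v] onto
    [T]; the projections for complementary sets add up to [v]. *)
Lemma merge_subvec (R : realType) (p : nat) (S : {set 'I_p}) (v : 'cV[R]_p) :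
  Defs.merge (subvec S v) (subvec (~: S) v) = v.
Proof.
have part (T : {set 'I_p}) i :
    ((subvec T 1%:M)^T *m subvec T v) i 0 = if i \in T then v i 0 else 0.
  rewrite mxE (eq_bigr (fun j : 'I_#|T| =>
    (fun i' => (i' == i)%:R * v i' 0) (enum_val j))); last by move=> j _; rewrite !mxE.
  rewrite -(big_enum_val (A := mem T) (fun i' => (i' == i)%:R * v i' 0)) /=.
  case: ifP => iT.
    rewrite (bigD1 i) //= eqxx mul1r big1 ?addr0 // => i' /andP[_ /negPf ->].
    by rewrite mul0r.
  rewrite big1 // => i' i'T; case: eqP => [E|]; last by rewrite mul0r.
  by rewrite -E i'T in iT.
apply/colP => i; rewrite mxE !part finset.in_setC.
by case: (i \in S); rewrite ?addr0 ?add0r.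
Qed.

Section Deterministic.
Variables (R : realType) (n m p : nat).
Variables (A : 'M[R]_n) (B : 'M[R]_(n, m)) (C : 'M[R]_(p, n)) (D : deepc R m p).
Variables (xd : int -> 'cV[R]_n) (yo atk : int -> 'cV[R]_p).
Local Notation S := (prot D).
Hypothesis ctr : controllable A B.
Hypothesis obs : observable A (subvec S C).
Hypothesis nTp : (n <= Tp D)%N.
Hypothesis data : offline_data A B C D xd yo atk.
Hypothesis pe_data : pe (ud D) (Tp D)%:Z (Nd D - Tp D) (n + Tp D + Tf D).

Lemma offline_subvec (t : int) : 0 <= t < (Nd D)%:Z ->
  subvec S (yd D t) = subvec S C *m xd t.
Proof.
move=> tN; case: data => _ yoC ydE atk0.
rewrite -subvec_mul -yoC // ydE //; apply/colP => i.
by rewrite !mxE atk0 ?addr0 // enum_valP.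
Qed.

Section Online.
Variables (x : int -> 'cV[R]_n) (u : int -> 'cV[R]_m) (y : int -> 'cV[R]_p).
Hypothesis dyn : forall t, - (Tp D)%:Z <= t -> x (t + 1) = A *m x t + B *m u t.
Hypothesis out : forall t, - (Tp D)%:Z <= t -> y t = C *m x t.

Lemma Zmat_hankel k : Zmat D u y k =
  col_mx (hankel_cols u (- (Tp D)%:Z) (Tp D) k)
         (hankel_cols (fun t => subvec S (y t)) (- (Tp D)%:Z) (Tp D) k).
Proof.
apply/matrixP => r l; rewrite mxE [RHS]mxE /zeta [LHS]mxE.
case: fintype.split => r'; rewrite [RHS]mxE addrC //. 
Qed.

Lemma Zmat_mul k (g : 'cV[R]_k) : Zmat D u y k *m g =
  col_mx (\mxcol_(s < Tp D) \sum_(l < k) g l 0 *: u (- (Tp D)%:Z + l%:Z + s%:Z))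
    (\mxcol_(s < Tp D)
      (subvec S C *m \sum_(l < k) g l 0 *: x (- (Tp D)%:Z + l%:Z + s%:Z))).
Proof.
rewrite Zmat_hankel mul_col_mx !hankel_cols_mul; congr col_mx.
apply: eq_mxcol => s; rewrite mulmx_sumr; apply: eq_bigr => l _.
by rewrite -scalemxAr -subvec_mul out //; lia.
Qed.

Lemma YUmat_mul k (g : 'cV[R]_k) : YUmat D y k *m g =
  subvec (~: S)%SET C *m \sum_(l < k) g l 0 *: x l%:Z.
Proof.
rewrite mulmx_sum_col mulmx_sumr; apply: eq_bigr => l _.
rewrite -scalemxAr; congr (_ *: _); rewrite -subvec_mul -out; last by lia.
by apply/colP => r; rewrite !mxE.
Qed.

Lemma combination_dyn k (g : 'cV[R]_k) s :
  \sum_(l < k) g l 0 *: x (- (Tp D)%:Z + l%:Z + s.+1%:Z) =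
  A *m (\sum_(l < k) g l 0 *: x (- (Tp D)%:Z + l%:Z + s%:Z))
  + B *m \sum_(l < k) g l 0 *: u (- (Tp D)%:Z + l%:Z + s%:Z).
Proof.
rewrite !mulmx_sumr -big_split; apply: eq_bigr => l _ /=.
rewrite -!scalemxAr -scalerDr -dyn; last by lia.
by rewrite -[in RHS]addrA -PoszD addn1.
Qed.

Lemma sum_shift k (g : 'cV[R]_k) :
  \sum_(l < k) g l 0 *: x (- (Tp D)%:Z + l%:Z + (Tp D)%:Z) =
  \sum_(l < k) g l 0 *: x l%:Z.
Proof. by apply: eq_bigr => l _; congr (_ *: x _); lia. Qed.

(* The row space of YU lies in that of Z: an input-output window that vanishes
   forces the state, hence the unprotected output, to vanish. *)
Lemma Fmat_Zmat k : Fmat D u y k *m Zmat D u y k = YUmat D y k.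
Proof.
have ker0 (h : 'cV[R]_k) : Zmat D u y k *m h = 0 -> YUmat D y k *m h = 0.
  rewrite Zmat_mul YUmat_mul -[RHS in _ = RHS -> _]col_mx0 => /eq_col_mx [].
  rewrite -(mxcol0 (p_ := fun=> m)) -(mxcol0 (p_ := fun=> #|S|)).
  move=> /eq_mxcolP u0 /eq_mxcolP y0.
  rewrite -sum_shift; set X := fun s : nat =>
    \sum_(l < k) h l 0 *: x (- (Tp D)%:Z + l%:Z + s%:Z).
  rewrite -[X in _ *m X]/(X (Tp D)).
  (* The combined trajectory has zero input and zero protected output over the window, so it is
     compared with the zero trajectory. *)
  rewrite (@state_unique R n m _ (Tp D) A B _ X (fun=> 0) (fun=> 0) obs) ?mulmx0 //.
  - move=> s sT; rewrite /X combination_dyn; congr (_ + _).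
    by rewrite (u0 (Ordinal sT)) mulmx0.
  - by move=> s _; rewrite addr0.
  - by move=> s sT; exact: (y0 (Ordinal sT)).
have [ZXZ _ _ _] := pinvP (Zmat D u y k).
(* With [X] the pseudoinverse of [Z], the columns of [X Z - 1] lie in the kernel of [Z], hence in
   that of [YU]; this is [YU X Z = YU]. *)
have K : Zmat D u y k *m (Defs.pinv (Zmat D u y k) *m Zmat D u y k - 1%:M) = 0.
  by rewrite mulmxBr mulmxA ZXZ mulmx1 subrr.
apply/eqP; rewrite /Fmat -mulmxA -subr_eq0 -{2}(mulmx1 (YUmat D y k)) -mulmxBr.
apply/eqP/matrixP => i j; rewrite [RHS]mxE.
have := ker0 (col j (Defs.pinv (Zmat D u y k) *m Zmat D u y k - 1%:M)).
rewrite !colE !mulmxA K mul0mx => /(_ erefl) /matrixP /(_ i 0).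
by rewrite -colE !mxE.
Qed.

(** Some [g] combines the online windows into the offline one; then [F] maps [Z g] to [YU g], the
    unprotected output of the combined state [xd t]. Excitation at time [k] concerns [Tp + k]
    inputs, hence [k.+1] windows of length [Tp]: this is the delay of one step in the switching
    time. *)
Lemma yhat_exact k (t : int) : online_pe D u k ->
  (Tp D)%:Z <= t < (Nd D)%:Z -> yhat D u y k.+1 t = C *m xd t.
Proof.
move=> peu tN; have [xd_dyn _ _ _] := data.
(* Order [2 * Tp] covers [n + Tp] because [n <= Tp]. *)
have pe' : pe u (- (Tp D)%:Z) (Tp D + k) (n + Tp D).
  by apply: pe_le peu; lia.
have kE : k.+1 = ((Tp D + k).+1 - Tp D)%N by lia.
have [|g [gx gu]] := willems_pe _ _ _ _ _ x _ _ _ _ k.+1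
  (xd (t - (Tp D)%:Z)) (fun s => ud D (t - (Tp D)%:Z + s%:Z)) ctr pe' kE.
  by move=> l lk; apply: dyn; lia.
have traj : forall s, (s <= Tp D)%N ->
    \sum_(l < k.+1) g l 0 *: x (- (Tp D)%:Z + l%:Z + s%:Z) = xd (t - (Tp D)%:Z + s%:Z).
  elim=> [|s IH] sT.
    by rewrite addr0 -gx; apply: eq_bigr => l _; rewrite addr0.
  rewrite combination_dyn IH 1?ltnW // gu //.
  by rewrite -xd_dyn; [rewrite -addrA -PoszD addn1|lia|lia].
rewrite /yhat offline_subvec; last by lia.
suff -> : zeta D (ud D) (yd D) t = Zmat D u y k.+1 *m g.
  rewrite mulmxA Fmat_Zmat YUmat_mul -sum_shift traj //.
  by rewrite -(subvec_mul) -subvec_mul subrK merge_subvec.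
rewrite Zmat_mul /zeta /stack; congr col_mx; apply: eq_mxcol => s.
  by rewrite gu.
by rewrite traj 1?ltnW // offline_subvec //; have := ltn_ord s; lia.
Qed.


(** The past constraints force the combined state to be the true state at time [k], by
    observability, so the future rows are plant predictions. Conversely Willems' lemma yields a [g]
    for any MPC trajectory. *)
Lemma phase2_mpc_feasible k0 k uf yf : online_pe D u k0 ->
  (exists g, phase2_feasible u y k0.+1 k (Plan g uf yf)) <->
  mpc_feasible (D := D) A B C (x k%:Z) (uf, yf).
Proof.
move=> peu; have [xd_dyn _ _ _] := data; have Tf0 := Tf_gt0 D.
pose c := ((Nd D - Tp D).+1 - (Tp D + Tf D))%N.
pose Xs (g : 'cV[R]_c) (j : nat) := \sum_(l < c) g l 0 *: xd ((Tp D)%:Z + l%:Z + j%:Z).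
pose Us (g : 'cV[R]_c) (j : nat) := \sum_(l < c) g l 0 *: ud D ((Tp D)%:Z + l%:Z + j%:Z).
have idx (l j : nat) : (l < c)%N -> (j < Tp D + Tf D)%N ->
    (Tp D)%:Z <= (Tp D)%:Z + l%:Z + j%:Z < (Nd D)%:Z.
  by move: Tf0; rewrite /c; clear; lia.
have Xs_dyn g j : (j.+1 < Tp D + Tf D)%N -> Xs g j.+1 = A *m Xs g j + B *m Us g j.
  move=> jT; rewrite !mulmx_sumr -big_split; apply: eq_bigr => l _ /=.
  have := idx _ _ (ltn_ord l) jT; rewrite -addn1 PoszD addrA => lj.
  by rewrite -!scalemxAr -scalerDr -xd_dyn //; move: lj; clear; lia.
have Ys (g : 'cV[R]_c) j : (j < Tp D + Tf D)%N ->
    \sum_(l < c) g l 0 *: yhat D u y k0.+1 ((Tp D)%:Z + l%:Z + j%:Z) = C *m Xs g j.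
  move=> jT; rewrite mulmx_sumr; apply: eq_bigr => l _.
  by rewrite yhat_exact ?scalemxAr //; apply: idx.
have x_dyn j : x (k%:Z - (Tp D)%:Z + j.+1%:Z) =
    A *m x (k%:Z - (Tp D)%:Z + j%:Z) + B *m u (k%:Z - (Tp D)%:Z + j%:Z).
  by rewrite -dyn; [rewrite -[in RHS]addrA -PoszD addn1|lia].
(* The past rows start at offline time [Tp] and the future rows [Tp] later; both are read as one
   window, with offset [Tp + j] for the future. *)
have future q (v : int -> 'cV[R]_q) (g : 'cV[R]_c) j :
    \sum_(l < c) g l 0 *: v ((Tp D)%:Z + (Tp D)%:Z + l%:Z + j%:Z) =
    \sum_(l < c) g l 0 *: v ((Tp D)%:Z + l%:Z + (Tp D + j)%:Z).
  by apply: eq_bigr => l _; congr (_ *: v _); lia.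
split=> [[g [/= up_eq yp_eq uf_eq yf_eq constr]]|[/= constr [xf [xf0 xfP]]]].
  move: up_eq yp_eq uf_eq yf_eq.
  rewrite /past_hankel /future_hankel /stack !hankel_cols_mul.
  move=> /eq_mxcolP upE /eq_mxcolP ypE /eq_mxcolP ufE /eq_mxcolP yfE.
  split=> //=.
  have Xx : forall s, (s <= Tp D)%N -> Xs g s = x (k%:Z - (Tp D)%:Z + s%:Z).
    apply: (@state_unique R n m _ (Tp D) A B (subvec S C) _ _
              (fun s => u (k%:Z - (Tp D)%:Z + s%:Z)) obs) => // s sT.
      by rewrite Xs_dyn; [rewrite -(upE (Ordinal sT))|lia].
    rewrite -!subvec_mul -Ys; last by lia.
    by rewrite (ypE (Ordinal sT)) out //; lia.
  pose xf := state A B (x k%:Z) (fun j => Us g (Tp D + j)%N).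
  have xfE j : (j < Tf D)%N -> xf j = Xs g (Tp D + j)%N.
    elim: j => [|j IH] jT; first by rewrite addn0 Xx // subrK.
    by rewrite addnS Xs_dyn -?IH //; lia.
  exists xf; split=> // j; split.
    by congr (_ + B *m _); rewrite -ufE future.
  by rewrite -yfE future Ys ?xfE //; have := ltn_ord j; lia.
(* The measured past inputs followed by [uf]; the value 0 lies beyond the horizon. With the state at
   the start of the past window, these inputs fix the whole trajectory. *)
pose tgt s := if (s < Tp D)%N then u (k%:Z - (Tp D)%:Z + s%:Z)
              else if insub (s - Tp D)%N is Some j then uf j else 0.
have pe' : pe (ud D) (Tp D)%:Z (Nd D - Tp D) (n + (Tp D + Tf D)) by rewrite addnA.
have [|g [gx gu]] := willems_pe _ _ _ A B xd _ _ _ _ c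
  (x (k%:Z - (Tp D)%:Z)) tgt ctr pe' erefl.
  by move=> l lc; apply: xd_dyn; rewrite /c in lc; lia.
have Xx s : (s <= Tp D)%N -> Xs g s = x (k%:Z - (Tp D)%:Z + s%:Z).
  elim: s => [|s IH] sT.
    by rewrite addr0 -gx; apply: eq_bigr => l _; rewrite addr0.
  rewrite Xs_dyn; last by lia.
  by rewrite x_dyn IH 1?ltnW // /Us gu /tgt ?sT //; lia.
have Uf (j : 'I_(Tf D)) : Us g (Tp D + j)%N = uf j.
  have jT := ltn_ord j; rewrite /Us gu; last by lia.
  by rewrite /tgt ifF ?addKn ?valK //; lia.
have Xf j : (j < Tf D)%N -> Xs g (Tp D + j)%N = xf j.
  elim: j => [|j IH] jT; first by rewrite addn0 Xx // subrK xf0.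
  rewrite addnS Xs_dyn; last by lia.
  have jT' := ltnW jT; rewrite IH // (xfP (Ordinal jT')).1 /=.
  by rewrite -(Uf (Ordinal jT')).
exists g; split=> //=; rewrite /past_hankel /future_hankel hankel_cols_mul;
  apply: eq_mxcol => s; have sT := ltn_ord s.
- by rewrite gu; [rewrite /tgt sT|lia].
- rewrite Ys; last by lia.
  by rewrite Xx 1?ltnW // out //; lia.
- by rewrite future -[RHS]Uf.
- by rewrite future Ys ?Xf ?(xfP s).2 //; lia.
Qed.

End Online.

Lemma tau_swP (u : int -> 'cV[R]_m) s :
  tau_sw D u = Some s -> exists2 k, online_pe D u k & s = k.+1.
Proof.
rewrite /tau_sw /tau_pe; case: pselect => //= h [<-].
by exists (ex_minn h) => //; case: ex_minnP.
Qed.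

(** The cost involves only [(uf, yf)], so equality of the feasible sets after projecting out [g]
    carries optimality over. *)
Lemma mpc_equivalent_after_switch (up : int -> 'cV[R]_m) (yp : int -> 'cV[R]_p)
    (e : run D n) s k :
  secure_deepc A B C up yp e -> recursively_feasible e ->
  tau_sw D (run_u e) = Some s -> (s <= k)%N ->
  mpc_equivalent A B C e s k /\ constraints_hold e k.
Proof.
move=> [_ dynout _ phase2] feas sw sk.
have dyn t (ht : - (Tp D)%:Z <= t) := (dynout t ht).1.
have out t (ht : - (Tp D)%:Z <= t) := (dynout t ht).2.
have [k0 pe0 s_k0] := tau_swP _ _ sw.
have equiv (uf : 'I_(Tf D) -> 'cV[R]_m) (yf : 'I_(Tf D) -> 'cV[R]_p) :
    (exists g, phase2_feasible (run_u e) (run_y e) s k (Plan g uf yf)) <->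
    mpc_feasible A B C (run_x e k%:Z) (uf, yf).
  by rewrite s_k0; exact: (phase2_mpc_feasible _ _ _ dyn out k0).
(* Recursive feasibility, iterated from [s] to [k]. *)
have nonempty : phase2_feasible (D := D) (run_u e) (run_y e) s k !=set0.
  have [base step] := feas s sw; rewrite -(subnKC sk).
  elim: (k - s)%N => [|j IH]; first by rewrite addn0; exact: base.
  by rewrite addnS; apply: step => //; exact: leq_addr.
have [opt uk] := phase2 s sw k sk; have := opt nonempty.
rewrite /mpc_equivalent /constraints_hold.
case: (run_plan2 e k) uk => gz uz yz /= uk {}opt.
have opt_equiv (uf : 'I_(Tf D) -> 'cV[R]_m) (yf : 'I_(Tf D) -> 'cV[R]_p) :
    (exists g, phase2_optimal (run_u e) (run_y e) s k (Plan g uf yf)) <->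
    mpc_optimal A B C (run_x e k%:Z) k (uf, yf).
  split=> [[g [fg ming]]|[fm minm]].
    split; first by apply/equiv; exists g.
    by move=> [uf' yf'] /equiv [g' fg']; exact: ming fg'.
  have [g fg] := (equiv _ _).2 fm; exists g; split=> // -[g' uf' yf'] fg'.
  by apply: minm (uf', yf') _; apply/equiv; exists g'.
have mopt : mpc_optimal A B C (run_x e k%:Z) k (uz, yz).
  by apply/opt_equiv; exists gz.
have [[constr [xf [xf0 xfP]]] _] := mopt.
(* The MPC prediction starts at the true state, so its first output is the measured one. *)
have yk : run_y e k%:Z = first yz.
  have hk : - (Tp D)%:Z <= k%:Z by clear; lia.
  by have [_ /= y0] := xfP (Ordinal (Tf_gt0 D)); rewrite out // /first y0 xf0.
split; first by split.
by rewrite uk yk; exact: constr.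
Qed.

End Deterministic.

(** * Excitation by the dither *)

Section Independence.
Context {R : realType} {d : measure_display} {Omega : measurableType d}.
Variable P : probability Omega R.
Local Open Scope ereal_scope.

(** Independence makes the joint law the product law, and Fubini integrates the zero measures of the
    sections. *)
Lemma indep_section_null {d1 d2 : measure_display} {T1 : measurableType d1}
    {T2 : measurableType d2} (X : {mfun Omega >-> T1}) (Y : {mfun Omega >-> T2})
    (N : set (T1 * T2)) :
  measurable N ->
  (forall A B, measurable A -> measurable B ->
     P (X @^-1` A `&` Y @^-1` B) = P (X @^-1` A) * P (Y @^-1` B)) ->
  (forall x, P (Y @^-1` xsection N x) = 0) ->
  P ((fun omega => (X omega, Y omega)) @^-1` N) = 0.
Proof.
move=> mN ind sec0.
have mXY : measurable_fun setT (fun omega => (X omega, Y omega)).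
  exact: measurable_fun_pair.
pose XY : {mfun Omega >-> (T1 * T2)%type} :=
  HB.pack (fun omega => (X omega, Y omega)) (isMeasurableFun.Build _ _ _ _ _ mXY).
have E : (distribution P X \x distribution P Y) N = distribution P XY N.
  apply: product_measure_unique => //.
have -> : P ((fun omega => (X omega, Y omega)) @^-1` N) = distribution P XY N by [].
rewrite -E.
rewrite /product_measure1 (eq_integral (cst 0)). rewrite integral0 //.  move=> x _.
exact: sec0.
Qed.

(** Dynkin's argument: the events independent of [B] form a lambda-system containing the pi-system
    [G]. *)
Lemma indep_g_sigma (G : set (set Omega)) (B : set Omega) :
  setI_closed G -> G `<=` measurable -> measurable B ->
  (forall S, G S -> P (S `&` B) = P S * P B) ->
  forall S, <<s G >> S -> P (S `&` B) = P S * P B.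
Proof.
move=> GI Gm mB ind.
suff : <<s G >> `<=` [set S | measurable S /\ P (S `&` B) = P S * P B].
  by move=> H S /H [].
apply: lambda_system_subset => //; last by move=> S GS; split; [exact: Gm|exact: ind].
apply/dynkin_lambda_system; split => /=.
- by split=> //; rewrite setTI probability_setT mul1e.
- move=> S [mS iS]; split; first exact: measurableC.
  have finB : P B \is a fin_num by exact: fin_num_measure.
  rewrite setIC -setDE measureD //; last by rewrite ltey_eq finB.
  rewrite [B `&` S]setIC [X in _ - X]iS probability_setC // muleBl ?mul1e //.
- move=> F tF HF; have mF n := (HF n).1; have iF n := (HF n).2.
  have mU : measurable (\bigcup_k F k) by exact: bigcup_measurable.
  split=> //; rewrite setI_bigcupl.
  rewrite !measure_semi_bigcup //; first last.
  + by apply: bigcup_measurable => n _; apply: measurableI.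
  + exact: trivIset_setIr.
  + by move=> n; apply: measurableI.
  have finB : P B \is a fin_num by exact: fin_num_measure.
  rewrite (eq_eseriesr (fun n _ => iF n)) muleC -(fineK finB) -nneseriesZl //.
  by apply: eq_eseriesr => n _; rewrite muleC.
Qed.

End Independence.

Lemma measurable_entry {R : realType} {q : nat} (i : 'I_q) :
  measurable_fun setT (fun x : 'cV[R]_q => x i 0).
Proof.
move=> _ Y mY; rewrite setTI; apply: sub_sigma_algebra => /=.
rewrite -bigcup_seq /=; exists i => /=; first by rewrite mem_index_enum.
by exists Y => //; rewrite setTI.
Qed.

(** * Functions affine in each entry of a sequence *)

Definition update {T : Type} (u : nat -> T) (t : nat) (x : T) : nat -> T :=
  fun s => if s == t then x else u s.

(** Affinity in the vector [u t] is expanded along the basis vectors, so that every coefficient is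
    made of values of [f] itself. *)
Definition multiaffine {R : realType} {q : nat} (K : nat)
    (f : (nat -> 'cV[R]_q) -> R) : Prop :=
  (forall u u', (forall t, (t < K)%N -> u t = u' t) -> f u = f u') /\
  forall u t x, f (update u t x) = f (update u t 0) +
    \sum_i x i 0 * (f (update u t (delta_mx i 0)) - f (update u t 0)).

Section Multiaffine.
Context {R : realType} {q : nat}.
Implicit Types (f : (nat -> 'cV[R]_q) -> R) (u : nat -> 'cV[R]_q).

Lemma update_id u t : update u t (u t) = u.
Proof. by apply/funext => s; rewrite /update; case: eqP => [->|]. Qed.

Lemma update_same u t x y : update (update u t x) t y = update u t y.
Proof. by apply/funext => s; rewrite /update; case: eqP. Qed.

Lemma update_comm u s t x y : s != t ->
  update (update u s x) t y = update (update u t y) s x.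
Proof.
move=> st; apply/funext => r; rewrite /update.
by case: eqP => [->|//]; rewrite eq_sym (negPf st).
Qed.

(** Freezing the last entry is the step of the inductions on [K] below. *)
Lemma multiaffine_update K f x :
  multiaffine K.+1 f -> multiaffine K (fun u => f (update u K x)).
Proof.
move=> [fK fa]; split=> [u u' uu'|u t y].
  apply: fK => t; rewrite ltnS leq_eqVlt /update; case: eqP => //= _; exact: uu'.
have [->|tK] := eqVneq t K.
  by rewrite !update_same big1 ?addr0 // => i _; rewrite !update_same subrr mulr0.
have C z : update (update u t z) K x = update (update u K x) t z.
  exact: update_comm.
by rewrite !C fa; under [in RHS]eq_bigr do rewrite C.
Qed.

Lemma multiaffine_measurable {d : measure_display} {T : measurableType d} K f
    (U : nat -> T -> 'cV[R]_q) :
  multiaffine K f ->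
  (forall t i, (t < K)%N -> measurable_fun setT (fun omega => U t omega i 0)) ->
  measurable_fun setT (fun omega => f (U^~ omega)).
Proof.
elim: K f => [|K IH] f fa mU.
  have -> : (fun omega => f (U^~ omega)) = cst (f (fun=> 0)).
    by apply/funext => omega; apply: fa.1.
  exact: measurable_cst.
have mU' x : measurable_fun setT (fun omega => f (update (U^~ omega) K x)).
  apply: (IH (fun u => f (update u K x))); first exact: multiaffine_update.
  by move=> t i tK; apply: mU; exact: ltnW.
have -> : (fun omega => f (U^~ omega)) = (fun omega => f (update (U^~ omega) K 0) +
    \sum_i U K omega i 0 * (f (update (U^~ omega) K (delta_mx i 0))
                            - f (update (U^~ omega) K 0))).
  by apply/funext => omega; rewrite -fa.2 update_id.
apply: measurable_funD => //; apply: measurable_sum => i.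
by apply: measurable_funM; [exact: mU|exact: measurable_funB].
Qed.

End Multiaffine.

(** * Almost sure nonvanishing of multiaffine functions of the input *)

Section Excitation.
Context {R : realType} {d : measure_display} {Omega : measurableType d}.
Variables (P : probability Omega R) (m : nat) (W : set 'cV[R]_m).
Variables (w v : nat -> Omega -> 'cV[R]_m).
Hypothesis iid : iid_dither P W w.
Hypothesis nonant : nonanticipative w v.
Hypothesis hyperplane0 : forall k (c : 'I_m -> R) (b : R) i, c i != 0 ->
  P (w k @^-1` [set x : 'cV[R]_m | \sum_j x j 0 * c j = b]) = 0%E.

(* A pi-system generating the sigma-algebra of w(0), ..., w(k-1). *)
Definition past k : set (set Omega) :=
  [set S | exists2 A : nat -> set 'cV[R]_m, (forall j, measurable (A j)) &
    S = \bigcap_(j in [set` iota 0 k]) (w j @^-1` A j)].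

Lemma past_setI k : setI_closed (past k).
Proof.
move=> _ _ [A mA ->] [A' mA' ->]; exists (fun j => A j `&` A' j).
  by move=> j; apply: measurableI.
rewrite -bigcapI; apply: eq_bigcapr => j _; exact: preimage_setI.
Qed.

Lemma measurable_dither k A : measurable A -> measurable (w k @^-1` A).
Proof. by move=> mA; case: iid => mw _ _ _ _; rewrite -[X in measurable X]setTI; apply: mw. Qed.

Lemma past_measurable k : past k `<=` measurable.
Proof.
move=> _ [A mA ->]; apply: bigcap_measurableType => j _; exact: measurable_dither.
Qed.

Lemma past_indep k S A : <<s past k >> S -> measurable A ->
  P (S `&` w k @^-1` A) = (P S * P (w k @^-1` A))%E.
Proof.
move=> pS mA; apply: indep_g_sigma pS; [exact: past_setI|exact: past_measurable
  |exact: measurable_dither|].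
move=> _ [A' mA' ->]; case: iid => _ ind _ _ _.
(* Inserting [A] at index [k] turns the intersection into one product event of [w 0, ..., w k], to
   which joint independence applies. *)
pose A'' j := if j == k then A else A' j.
have mA'' j : measurable (A'' j) by rewrite /A''; case: eqP.
have AE j : j \in iota 0 k -> A'' j = A' j.
  by rewrite mem_iota /A''; case: eqP => // ->; rewrite ltnn.
have -> : \bigcap_(j in [set` iota 0 k]) (w j @^-1` A' j) =
          \bigcap_(j in [set` iota 0 k]) (w j @^-1` A'' j).
  by apply: eq_bigcapr => j /= jk; rewrite AE.
have -> : w k @^-1` A = w k @^-1` A'' k by rewrite /A'' eqxx.
have -> : \bigcap_(j in [set` iota 0 k]) (w j @^-1` A'' j) `&` w k @^-1` A'' k =
    \bigcap_(j in [set` iota 0 k.+1]) (w j @^-1` A'' j).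
  rewrite -[k.+1]addn1 iotaD /= add0n; apply/seteqP; split=> omega /=.
    move=> [H1 H2] j /=; rewrite mem_cat inE => /orP [/H1 //|/eqP -> //].
  move=> H; split=> [j /= jk|]; apply: H => /=; rewrite mem_cat ?jk //.
  by rewrite inE eqxx orbT.
rewrite !ind ?iota_uniq // -[k.+1]addn1 iotaD add0n big_cat /=.
by rewrite big_seq1.
Qed.

Lemma past_mono j k : (j <= k)%N -> past j `<=` past k.
Proof.
move=> jk _ [A mA ->].
exists (fun i => if (i < j)%N then A i else setT); first by move=> i; case: ifP.
apply/seteqP; split=> omega /= H i /=.
  by rewrite mem_iota /= => ik; case: ifP => // ij; apply: H; rewrite /= mem_iota.
rewrite mem_iota /= add0n => ij; have := H i; rewrite /= mem_iota ij; apply.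
exact: leq_trans ij jk.
Qed.

Lemma past_dither j k A : (j < k)%N -> measurable A -> past k (w j @^-1` A).
Proof.
move=> jk mA; exists (fun i => if i == j then A else setT); first by move=> i; case: ifP.
apply/seteqP; split=> omega /= H; first by move=> i /= _; case: eqP => // ->.
by have := H j; rewrite /= eqxx mem_iota; apply.
Qed.

Lemma past_nonanticipative k A : measurable A -> <<s past k >> (v k @^-1` A).
Proof.
move=> mA; apply: (smallest_sub _ _ (nonant k A mA)).
  exact: smallest_sigma_algebra.
rewrite -bigcup_seq => S [/= j _ [B mB <-]]; rewrite setTI.
apply: sub_sigma_algebra; apply: past_dither => //; exact: ltn_ord.
Qed.

(** The sample space equipped with the sigma-algebra of the past, so that depending on the past only
    is plain measurability. *)
Let Om k := g_sigma_algebraType (past k).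

Lemma measurable_past_input j k i : (j < k)%N ->
  measurable_fun setT (fun omega : Om k => (v j omega + w j omega) i 0).
Proof.
move=> jk; have -> : (fun omega : Om k => (v j omega + w j omega) i 0) =
   ((fun x : 'cV[R]_m => x i 0) \o v j) \+ ((fun x : 'cV[R]_m => x i 0) \o w j).
  by apply/funext => omega; rewrite mxE.
apply: measurable_funD.
  apply: measurableT_comp; first exact: measurable_entry.
  move=> _ A mA; rewrite setTI.
  apply: (smallest_sub _ _ (past_nonanticipative j A mA)).
    exact: smallest_sigma_algebra.
  apply: subset_trans (past_mono _ _ (ltnW jk)) _; exact: sub_sigma_algebra.
apply: measurableT_comp; first exact: measurable_entry.
by move=> _ A mA; rewrite setTI; apply: sub_sigma_algebra; exact: past_dither.
Qed.


(** Given the past, [f] is affine in [w K]. If it is not constant, its zeros form a null hyperplane;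
    if it is, it equals its value with entry [K] frozen, almost surely nonzero by induction. *)
Lemma multiaffine_null K (f : (nat -> 'cV[R]_m) -> R) (u0 : nat -> 'cV[R]_m) :
  multiaffine K f -> f u0 != 0 ->
  P.-negligible [set omega | f (fun t => v t omega + w t omega) = 0].
Proof.
elim: K f => [|K IH] f fa fu0.
  rewrite (_ : [set _ | _] = set0); first exact: negligible_set0.
  apply/seteqP; split=> // omega /= f0; move/eqP: fu0; apply.
  by rewrite -f0; apply: fa.1.
pose U omega t := v t omega + w t omega.
(* Freezing at [u0 K] keeps [u0] as a nonzero witness for the induction hypothesis. *)
pose g u := f (update u K (u0 K)).
have ga : multiaffine K g by exact: multiaffine_update.
have gU0 : P.-negligible [set omega | g (U omega) = 0].
  by apply: IH => //; rewrite /g update_id.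
pose b omega := f (update (U omega) K 0).
pose h i omega := f (update (U omega) K (delta_mx i 0)) - b omega.
have meas x : measurable_fun setT (fun omega : Om K => f (update (U omega) K x)).
  apply: (@multiaffine_measurable R m _ (Om K) K (fun u => f (update u K x))
    (fun t (omega : Om K) => v t omega + w t omega)); first exact: multiaffine_update.
  by move=> t i tK; exact: measurable_past_input.
have mh i : measurable_fun setT (h i : Om K -> R) by apply: measurable_funB; exact: meas.
have mv i : measurable_fun setT (fun omega : Om K => v K omega i 0).
  apply: (measurableT_comp (f := fun x : 'cV[R]_m => x i 0)); first exact: measurable_entry.
  by move=> _ A mA; rewrite setTI; exact: past_nonanticipative.
(* [f] at the random input as a function of the past, which includes [v K], and of the fresh
   [w K]. *)
pose phi (z : Om K * 'cV[R]_m) :=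
  b z.1 + \sum_i (v K z.1 i 0 + z.2 i 0) * h i z.1.
have mphi : measurable_fun setT phi.
  apply: measurable_funD; first exact: (measurableT_comp (meas 0)).
  apply: measurable_sum => i; apply: measurable_funM; last exact: (measurableT_comp (mh i)).
  apply: measurable_funD; first exact: (measurableT_comp (mv i)).
  exact: (measurableT_comp (measurable_entry i)).
(* Discarding the zeros of [g] makes every section of [N] empty or a hyperplane. *)
pose N := (phi @^-1` [set 0]) `&` ((g \o U \o fst) @^-1` (~` [set 0])).
have mN : measurable N.
  apply: measurableI; rewrite -[X in measurable X]setTI.
    by apply: mphi => //; exact: measurable_set1.
  have mgU : measurable_fun setT ((g \o U) \o fst : Om K * 'cV[R]_m -> R).
    exact: (measurableT_comp (meas (u0 K))).
  by apply: mgU => //; apply: measurableC; exact: measurable_set1.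
have fU omega : f (U omega) = phi (omega, w K omega).
  rewrite -[in LHS](update_id (U omega) K) fa.2; congr (_ + _).
  by apply: eq_bigr => i _; rewrite mxE.
have mid : measurable_fun setT (id : Omega -> Om K).
  move=> _ A mA; rewrite setTI.
  by apply: (smallest_sub _ _ mA); [exact: sigma_algebra_measurable|exact: past_measurable].
pose X : {mfun Omega >-> Om K} := HB.pack (id : Omega -> Om K) (isMeasurableFun.Build _ _ _ _ _ mid).
have mw : measurable_fun setT (w K) by case: iid.
pose Y : {mfun Omega >-> 'cV[R]_m} := HB.pack (w K) (isMeasurableFun.Build _ _ _ _ _ mw).
have N0 : P ((fun omega => (X omega, Y omega)) @^-1` N) = 0%E.
  apply: indep_section_null mN _ _ => [A A' mA mA'|omega]; first exact: past_indep.
  have [g0|g0] := eqVneq (g (U omega)) 0.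
    rewrite (_ : _ @^-1` _ = set0) ?measure0 //.
    by apply/seteqP; split=> // omega' /=; rewrite /xsection /= in_setE => -[].
  have -> : Y @^-1` xsection N omega = w K @^-1` [set x : 'cV[R]_m |
      \sum_j x j 0 * h j omega = - (b omega + \sum_j v K omega j 0 * h j omega)].
    apply/seteqP; split=> omega' /=; rewrite /xsection /= in_setE /N /phi /=.
      move=> [+ _]; under eq_bigr do rewrite mulrDl; rewrite big_split /= addrA.
      by move/eqP; rewrite addrC addr_eq0 => /eqP.
    move=> E; split; last exact/eqP.
    by under eq_bigr do rewrite mulrDl; rewrite big_split /= addrA E subrr.
  have [[i hi]|h0] := pselect (exists i, h i omega != 0); first exact: hyperplane0 hi.
  have {}h0 i : h i omega = 0.
    by apply/eqP/negPn/negP => hi; apply: h0; exists i.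
  (* All slopes vanish, so [f] does not depend on entry [K] and equals [g], which is nonzero
     here. *)
  have bg : b omega = g (U omega).
    by rewrite /g fa.2 big1 ?addr0 // => i _; rewrite -/(h i omega) h0 mulr0.
  rewrite (_ : _ @^-1` _ = set0) ?measure0 //; apply/seteqP; split=> // omega' /=.
  rewrite big1 => [|i _]; last by rewrite h0 mulr0.
  rewrite big1 ?addr0 => [|i _]; last by rewrite h0 mulr0.
  by move/eqP; rewrite eq_sym oppr_eq0 bg (negPf g0).
have sub : [set omega | f (U omega) = 0] `<=` [set omega | g (U omega) = 0]
    `|` ((fun omega => (X omega, Y omega)) @^-1` N).
  move=> omega /= f0; have [g0|/eqP g0] := eqVneq (g (U omega)) 0; first by left.
  by right; split; rewrite /= -?fU.
apply: negligibleS sub (negligibleU gU0 _); apply/negligibleP => //.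
have mXY : measurable_fun setT (fun omega => (X omega, Y omega)).
  exact: measurable_fun_pair.
by rewrite -[X in measurable X]setTI; exact: mXY.
Qed.

End Excitation.

(** * Hyperplanes are Lebesgue null *)

Section Hyperplane.
Context {R : realType}.

Lemma box_vol_ge0 (q : nat) (a b : 'cV[R]_q) : 0 <= box_vol a b.
Proof. by apply: prodr_ge0 => i _; rewrite le_max lexx. Qed.

Lemma lebesgue_outer_ge0 (q : nat) (N : set 'cV[R]_q) : (0 <= lebesgue_outer N)%E.
Proof.
apply: le_ereal_inf_tmp => _ [a [b [_ ->]]].
by apply: nneseries_ge0 => l _ _; rewrite lee_fin box_vol_ge0.
Qed.

(** The finite cover is padded to a sequence by boxes reduced to the point 0. Their volume is 0 as
    [0 < q]; an empty product would be 1. *)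
Lemma lebesgue_outer_le (q : nat) (I : finType) (a b : I -> 'cV[R]_q) (N : set 'cV[R]_q) :
  (0 < q)%N -> (forall x, N x -> exists t, box (a t) (b t) x) ->
  (lebesgue_outer N <= (\sum_t box_vol (a t) (b t))%:E)%E.
Proof.
move=> q0 cov; apply: ereal_inf_lbound.
pose ext (c : I -> 'cV[R]_q) l : 'cV[R]_q :=
  if insub l is Some j then c (enum_val (j : 'I_#|I|)) else 0.
exists (ext a), (ext b); split.
  move=> x /cov [t bx]; exists (enum_rank t : nat) => //.
  by rewrite /ext valK enum_rankK.
rewrite (nneseries_split 0%N #|I|) => [|l _]; last by rewrite lee_fin box_vol_ge0.
rewrite [X in (_ + X)%E]eseries0 ?adde0 => [|l]; last first.
  rewrite add0n => Il _; rewrite /ext insubF; last by rewrite ltnNge Il.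
  by rewrite /box_vol (bigD1 (Ordinal q0)) //= subrr maxxx mul0r.
rewrite add0n big_mkord sumEFin; congr (_%:E).
rewrite (reindex_onto enum_val (enum_rank (T := I))) => [|t _]; last exact: enum_rankK.
apply: eq_big => [l|l _]; first by rewrite enum_valK eqxx.
by rewrite /ext valK.
Qed.

(** The cell is the first whose right end reaches [t]; minimality bounds [t] from below. *)
Lemma grid_cell (M : nat) (r t : R) : (0 < M)%N -> - r <= t <= r ->
  exists j : 'I_M, - r + j%:R * (2 * r / M%:R) <= t <= - r + j.+1%:R * (2 * r / M%:R).
Proof.
move=> M0 /andP[rt tr]; have M0' : M%:R != 0 :> R by rewrite pnatr_eq0 -lt0n.
set dl := 2 * r / M%:R.
have Mdl : M%:R * dl = 2 * r by rewrite /dl mulrC divfK.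
have ex : exists k, t <= - r + k.+1%:R * dl.
  by exists M.-1; rewrite prednK // Mdl; lra.
case: (ex_minnP ex) => k tk kmin.
have kM : (k < M)%N.
  by rewrite -[M]prednK // ltnS; apply: kmin; rewrite prednK // Mdl; lra.
exists (Ordinal kM); rewrite /= tk andbT; case: k tk kmin kM => [|k] _ kmin _.
  by rewrite mul0r addr0.
rewrite leNgt; apply/negP => /ltW /kmin; by rewrite ltnn.
Qed.

(* Cover the graph over a grid of mesh dl in the other coordinates: above each
   cell the i-th coordinate varies by at most a constant times dl. *)
Lemma lebesgue_outer_hyperplane (q : nat) (c : 'I_q -> R) (b r : R) (i : 'I_q) :
  c i != 0 -> 0 < r ->
  lebesgue_outer [set x : 'cV[R]_q | \sum_j x j 0 * c j = b /\ forall j, - r <= x j 0 <= r] = 0%E.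
Proof.
move=> ci r0; set N := [set _ | _].
(* On the hyperplane, moving each other coordinate by at most [dl] moves the [i]-th by at most
   [G * dl]. [L / M] is the total volume of the covering boxes. *)
pose G := \sum_(j | j != i) `|c j / c i|.
have G0 : 0 <= G by apply: sumr_ge0.
pose L := 2 * G * (2 * r) * \prod_(j < q | j != i) (2 * r).
have L0 : 0 <= L.
  by rewrite /L !mulr_ge0 ?prodr_ge0 // => *; lra.
have q0 : (0 < q)%N by exact: leq_ltn_trans (leq0n i) (ltn_ord i).
suff bnd M : (0 < M)%N -> (lebesgue_outer N <= (L / M%:R)%:E)%E.
  apply/eqP; rewrite eq_le lebesgue_outer_ge0 andbT; apply/lee_addgt0Pr => e e0.
  rewrite add0e; pose M := (Num.truncn (L / e)).+1.
  apply: le_trans (bnd M isT) _; rewrite lee_fin ler_pdivrMr ?ltr0n //.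
  rewrite mulrC -ler_pdivrMr //; apply: ltW; exact: truncnS_gt.
move=> M0; have M0' : M%:R != 0 :> R by rewrite pnatr_eq0 -lt0n.
pose dl := 2 * r / M%:R.
have dl0 : 0 <= dl by rewrite /dl divr_ge0 ?ler0n //; lra.
pose lo (f : {ffun 'I_q -> 'I_M}) j := - r + (f j)%:R * dl.
(* The [i]-th coordinate of the hyperplane above the lower corner of cell [f]. *)
pose ce f := (b - \sum_(j | j != i) lo f j * c j) / c i.
pose z0 : 'I_M := Ordinal M0.
(* No grid is wanted along [i]: the thickness is [2 * G * dl] when [f i] is [z0] and 0 otherwise, so
   that the sum of volumes over [f] factors into a product over coordinates. *)
pose wd (j : 'I_q) (k : 'I_M) : R :=
  if j == i then (if k == z0 then G * dl *+ 2 else 0) else dl.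
pose A f : 'cV[R]_q := \col_j if j == i then ce f - G * dl else lo f j.
pose B (f : {ffun 'I_q -> 'I_M}) : 'cV[R]_q := \col_j (A f j 0 + wd j (f j)).
have volE f : box_vol (A f) (B f) = \prod_j wd j (f j).
  apply: eq_bigr => j _; rewrite [B f j 0]mxE addrC addKr; apply/max_idPr.
  rewrite /wd; case: ifP => _ //; case: ifP => _ //.
  by rewrite mulrn_wge0 // mulr_ge0.
have -> : L / M%:R = \sum_f box_vol (A f) (B f).
  under eq_bigr do rewrite volE.
  rewrite -bigA_distr_bigA (bigD1 i) //= (bigD1 z0) //=.
  rewrite big1 => [|k kz]; last by rewrite /wd eqxx (negPf kz).
  rewrite addr0 {1}/wd !eqxx (eq_bigr (fun=> 2 * r)) => [|j ji].
    by rewrite /L /dl mulr2n; ring.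
  by rewrite /wd (negPf ji) sumr_const card_ord -[LHS]mulr_natr divfK.
apply: lebesgue_outer_le => // x [xb xr].
have cell j := grid_cell M r (x j 0) M0 (xr j).
pose f : {ffun 'I_q -> 'I_M} := [ffun j => if j == i then z0 else projT1 (cid (cell j))].
have fP j : j != i -> lo f j <= x j 0 <= lo f j + dl.
  move=> ji; rewrite /lo ffunE (negPf ji); case: (cid (cell j)) => k /= /andP[-> /=].
  by rewrite -natr1 mulrDl mul1r addrA.
exists f => j; rewrite !mxE /wd; have [->|ji] := eqVneq j i; last exact: fP.
rewrite ffunE !eqxx.
suff : `|x i 0 - ce f| <= G * dl.
  by rewrite ler_norml => /andP[]; rewrite mulr2n => *; apply/andP; split; lra.
have -> : x i 0 - ce f = \sum_(j | j != i) (lo f j - x j 0) * (c j / c i).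
  apply: (mulIf ci); rewrite mulrBl /ce divfK // mulr_suml.
  have -> : \sum_(j0 | j0 != i) (lo f j0 - x j0 0) * (c j0 / c i) * c i =
    \sum_(j0 | j0 != i) lo f j0 * c j0 - \sum_(j0 | j0 != i) x j0 0 * c j0.
    by rewrite -sumrB; apply: eq_bigr => j0 _; rewrite mulrA divfK // mulrBl.
  by rewrite -xb (bigD1 i) //=; ring.
apply: le_trans (ler_norm_sum _ _ _) _; rewrite /G mulr_suml.
apply: ler_sum => j0 j0i; rewrite normrM mulrC ler_wpM2l //.
by have /andP[h1 h2] := fP _ j0i; rewrite ler_norml; apply/andP; split; lra.
Qed.

End Hyperplane.

Section Dither.
Context {R : realType} {d : measure_display} {Omega : measurableType d}.
Variables (P : probability Omega R) (m : nat) (W : set 'cV[R]_m).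
Variable w : nat -> Omega -> 'cV[R]_m.

Lemma dither_hyperplane_null k (c : 'I_m -> R) (b : R) i :
  iid_dither P W w -> c i != 0 ->
  P (w k @^-1` [set x : 'cV[R]_m | \sum_j x j 0 * c j = b]) = 0%E.
Proof.
move=> [mw _ _ ac _] ci; set H := [set x : 'cV[R]_m | _].
have mpre A : measurable A -> measurable (w k @^-1` A).
  by move=> mA; rewrite -[X in measurable X]setTI; apply: mw.
have mlin : measurable_fun setT (fun x : 'cV[R]_m => \sum_j x j 0 * c j).
  apply: measurable_sum => j; apply: measurable_funM; [exact: measurable_entry|exact: measurable_cst].
have mH : measurable H.
  by rewrite -[X in measurable X]setTI; apply: (mlin measurableT [set b]); exact: measurable_set1.
(* Exhaustion by cubes, since nullity is established for bounded pieces of the hyperplane. *)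
pose S l : set 'cV[R]_m := [set x | forall j, - l.+1%:R <= x j 0 <= l.+1%:R].
have mS l : measurable (S l).
  have -> : S l = \bigcap_(j in [set: 'I_m]) (fun x : 'cV[R]_m => x j 0) @^-1` `[- l.+1%:R, l.+1%:R].
    apply/seteqP; split=> x /= Sx j; first by move=> _; rewrite /= in_itv /=; exact: Sx.
    by have := Sx j Logic.I; rewrite /= in_itv.
  apply: fin_bigcap_measurable => // j _; rewrite -[X in measurable X]setTI.
  by apply: measurable_entry => //; exact: measurable_itv.
apply: measure_negligible; first exact: mpre.
suff : P.-negligible (\bigcup_l (w k @^-1` (H `&` S l))).
  apply: negligibleS.
  move=> omega Hw; set x := w k omega.
  pose l := Num.truncn (\sum_j `|x j 0|).
  exists l => //; split=> // j; rewrite -ler_norml; apply: ltW.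
  apply: le_lt_trans (truncnS_gt _).
  by rewrite (bigD1 j) //= lerDl sumr_ge0.
apply: negligible_bigcup => l; apply/negligibleP.
  by apply: mpre; exact: measurableI.
apply: ac; first exact: measurableI.
by apply: lebesgue_outer_hyperplane ci _; rewrite ltr0n.
Qed.

End Dither.

(** * The determinant of disjoint input windows *)

Section Windows.
Context {R : realType} {q m : nat}.
Local Notation N := (\sum_(s < q) m)%N.
Implicit Types u : nat -> 'cV[R]_m.

(* Disjoint windows make the determinant affine in each input. *)
Definition windows u : 'M[R]_N :=
  \matrix_(r < N, c < N) (\mxcol_(s < q) u (c * q + s)%N) r 0.

Lemma windows_lt (c : 'I_N) (s : 'I_q) : (c * q + s < N * q)%N.
Proof. by have := ltn_ord c; have := ltn_ord s; nia. Qed.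

Lemma windows_update u t x r (c : 'I_N) : (c : nat) != (t %/ q)%N ->
  windows (update u t x) r c = windows u r c.
Proof.
move=> ct; rewrite !mxE /update; case: eqP => // E.
have s_q := ltn_ord (tagnat.sig1 r).
by rewrite -E divnMDl ?divn_small ?addn0 ?eqxx // in ct; lia.
Qed.

(** The determinant is expanded along column [t %/ q], the only one that sees [u t], so the
    cofactors are constant in [u t]. Times beyond the last window change nothing. *)
Lemma multiaffine_det_windows : multiaffine (N * q) (fun u => \det (windows u)).
Proof.
split=> [u u' uu'|u t x].
  congr (\det _); apply/matrixP => r c; rewrite !mxE uu' //; exact: windows_lt.
have [tN|Nt] := ltnP (t %/ q)%N N; last first.
  have E y : windows (update u t y) = windows u.
    apply/matrixP => r c; apply: windows_update.
    by apply: contraTneq (ltn_ord c) => ->; rewrite -leqNgt.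
  by rewrite !E [X in _ + X]big1 ?addr0 // => i _; rewrite E subrr mulr0.
pose c := Ordinal tN.
have cof y r : cofactor (windows (update u t y)) r c = cofactor (windows u) r c.
  congr (_ * \det _); apply/matrixP => i j; rewrite !mxE.
  have := @windows_update u t y (lift r i) (lift c j); rewrite !mxE; apply.
  by have := neq_lift c j; rewrite -val_eqE eq_sym.
have entry y r : windows (update u t y) r c = windows (update u t 0) r c +
    \sum_i y i 0 * (windows (update u t (delta_mx i 0)) r c - windows (update u t 0) r c).
  (* Each entry reads a single coordinate of a single input. *)
  pose e z : R := update u t z (c * q + tagnat.sig1 r)%N (tagnat.sig2 r) 0.
  have We z : windows (update u t z) r c = e z by rewrite !mxE.
  transitivity (e 0 + \sum_i y i 0 * (e (delta_mx i 0) - e 0)); last first.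
    by rewrite We; congr (_ + _); apply: eq_bigr => i _; rewrite !We.
  rewrite We /e /update; case: eqP => _; last first.
    by rewrite [X in _ + X]big1 ?addr0 // => i _; rewrite subrr mulr0.
  rewrite [X in _ = X + _]mxE add0r (bigD1 (tagnat.sig2 r)) //=.
  rewrite [X in _ + X]big1 => [|i ir].
    by rewrite !mxE !eqxx subr0 mulr1 addr0.
  by rewrite !mxE [_ == i]eq_sym (negPf ir) subr0 mulr0.
have det y : \det (windows (update u t y)) =
    \sum_r windows (update u t y) r c * cofactor (windows u) r c.
  by rewrite (expand_det_col _ c); apply: eq_bigr => r _; rewrite cof.
rewrite !det; under eq_bigr do rewrite entry mulrDl.
rewrite big_split /=; congr (_ + _).
under eq_bigr do rewrite mulr_suml.
rewrite exchange_big; apply: eq_bigr => i _.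
rewrite det -sumrB mulr_sumr; apply: eq_bigr => r _.
ring.
Qed.

Lemma exists_det_windows : exists u, \det (windows u) != 0.
Proof.
(* Block [s] of the [c]-th unit vector is placed at time [c * q + s], which makes the window matrix
   the identity. *)
pose u t : 'cV[R]_m := if insub (t %/ q)%N is Some c then
  if insub (t %% q)%N is Some s then
    submxcol (col (c : 'I_N) 1%:M) (s : 'I_q) else 0 else 0.
exists u.
suff -> : windows u = 1%:M by rewrite det1 oner_neq0.
apply/matrixP => r c; rewrite !mxE.
have s_q := ltn_ord (tagnat.sig1 r).
rewrite /u divnMDl ?divn_small ?addn0 //; last by lia.
rewrite valK modnMDl modn_small // valK.
transitivity ((\mxcol_s submxcol (col c (1%:M : 'M[R]_N)) s) r (0 : 'I_1)); first by rewrite [RHS]mxE.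
by rewrite submxcolK !mxE.
Qed.

End Windows.

(** A left annihilator of the Hankel matrix annihilates the disjoint windows, which are among its
    columns and form an invertible matrix. *)
Lemma online_pe_windows (R : realType) (m p : nat) (D : deepc R m p)
    (u : int -> 'cV[R]_m) :
  \det (windows (q := 2 * Tp D) (fun t => u t%:Z)) != 0 -> exists k, online_pe D u k.
Proof.
set q := (2 * Tp D)%N; set N := (\sum_(s < q) m)%N => det0.
exists (N * q + q)%N; apply/peP => b b0 s sq.
pose z : 'rV[R]_N := \mxrow_(s < q) b s.
suff z0 : z = 0.
  by have := congr1 (fun M => submxrow M (Ordinal sq)) z0; rewrite mxrowK submxrow0.
have unitM : windows (q := q) (fun t => u t%:Z) \in unitmx by rewrite unitmxE unitfE.
rewrite -[z](mulmxK unitM) (_ : z *m _ = 0) ?mul0mx //; apply/matrixP => i c.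
(* Hankel columns start at time [- Tp], so the window starting at [c * q] is column [Tp + c * q]. *)
have lc : (Tp D + c * q < (Tp D + (N * q + q)).+1 - q)%N.
  by have := ltn_ord c; rewrite -/N; nia.
have := b0 _ lc.
have -> : \sum_(s < q) b s *m u (- (Tp D)%:Z + (Tp D + c * q)%N%:Z + s%:Z) =
    z *m col c (windows (q := q) (fun t => u t%:Z)).
  have -> : col c (windows (q := q) (fun t => u t%:Z)) =
      \mxcol_(s < q) u (c * q + s)%N%:Z.
    by apply/colP => r; rewrite !mxE.
  rewrite mul_mxrow_mxcol; apply: eq_bigr => r _; congr (_ *m u _); lia.
by rewrite -col_mulmx => /matrixP /(_ i 0); rewrite !mxE.
Qed.

(** * Almost sure switching and conclusion *)

Theorem theorem1 (R : realType) (n m p : nat)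
    (A : 'M[R]_n) (B : 'M[R]_(n, m)) (C : 'M[R]_(p, n)) (D : deepc R m p)
    (xd : int -> 'cV[R]_n) (yo atk : int -> 'cV[R]_p)
    (up : int -> 'cV[R]_m) (yp : int -> 'cV[R]_p)
    (d : measure_display) (Omega : measurableType d) (P : probability Omega R)
    (E : Omega -> run D n) :
  controllable A B ->
  observable A (subvec (prot D) C) ->
  (n <= Tp D)%N ->
  posdef (Qw D) -> posdef (Rw D) ->
  (Wd D)° 0 ->
  offline_data A B C D xd yo atk ->
  pe (ud D) (Tp D)%:Z (Nd D - Tp D) (n + Tp D + Tf D) ->
  (forall omega, secure_deepc A B C up yp (E omega)) ->
  iid_dither P (Wd D) (fun k omega => run_w (E omega) k) ->
  nonanticipative (fun k omega => run_w (E omega) k)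
    (fun k omega => first (plan_u (run_plan1 (E omega) k))) ->
  {ae P, forall omega, recursively_feasible (E omega) ->
    exists s, tau_sw D (run_u (E omega)) = Some s /\
      forall k, (s <= k)%N ->
        mpc_equivalent A B C (E omega) s k /\ constraints_hold (E omega) k}.
Proof.
move=> ctr obs nTp _ _ _ data pe_data closed_loop iid nonant.
have [u0 u0P] := @exists_det_windows R (2 * Tp D) m.
(* The determinant is evaluated on the Phase I signal [v + w] at all times, including those after a
   switch. *)
have := multiaffine_null P m (Wd D) _ _ iid nonant
  (fun k c b i => dither_hyperplane_null P m (Wd D) _ k c b i iid)
  _ _ u0 multiaffine_det_windows u0P.
apply: negligibleS => omega /= Hn; apply: contrapT => /eqP det0; apply: Hn => feas.
have [s|] := pselect (exists s, tau_sw D (run_u (E omega)) = Some s).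
  case: s => s sw; exists s; split=> // k sk.
  exact: mpc_equivalent_after_switch ctr obs nTp data pe_data _ _ _ _ _ (closed_loop omega) feas sw sk.
(* Without a switch the Phase I law holds at every time, so that signal is the applied input; its
   excitation contradicts the absence of a switch. *)
move=> no_sw; exfalso.
have sw : tau_sw D (run_u (E omega)) = None.
  by case: tau_sw no_sw => // s []; exists s.
have [_ _ phase1 _] := closed_loop omega.
have [k pek] : exists k, online_pe D (run_u (E omega)) k.
  apply: online_pe_windows; rewrite (_ : (fun t => _) = (fun t : nat =>
    first (plan_u (run_plan1 (E omega) t)) + run_w (E omega) t)) //.
  apply/funext => t; apply: (phase1 t _).2.
  by rewrite /before_sw sw.
move: sw; rewrite /tau_sw /tau_pe; case: pselect => // -[]; by exists k.
Qed.
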